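(* Let $1<p<\infty$. There is a constant $\gamma$ depending only on $p$ such that the following holds. Suppose $E$ is a Banach space, $Z$ is a Banach lattice, and $i:E\to Z$ is an isometric embedding with the following properties: (1) $Z$ is generated by $i(E)$ as a Banach lattice. (2) There exists a constant $C$ such that for every finite measure $\mu$, every bounded linear operator $T:E\to L_{p,\infty}(\mu)$ extends to a lattice homomorphism $T':Z\to L_{p,\infty}(\mu)$ (i.e. $T'i=T$) with $\|T'\|\le C\|T\|$. Then for any Banach lattice $X$ and any $(p,\infty)$-convex operator $S:E\to X$ there exists a (necessarily unique) lattice homomorphism $S':Z\to X$ satisfying $S'i=S$. Moreover, $\|S'\|\le\gamma\,C\,K^{(p,\infty)}(S)$, where $K^{(p,\infty)}(S)$ is the $(p,\infty)$-convexity constant of $S$.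
   Context: Banach spaces and lattices are real. $Z$ is generated by a set $A$ as a Banach lattice if the sublattice generated by $A$ is dense in $Z$. $L_{p,\infty}(\mu)$ is the space of (classes of) measurable $f$ with $\|f\|_{p,\infty}=(\sup_{t>0}t^p\mu(\{|f|>t\}))^{1/p}<\infty$, equipped with the equivalent lattice norm $\sup_{0<\mu(A)<\infty}\mu(A)^{-1+1/p}\int_A|f|\,d\mu$ and the a.e. order; it is a Banach lattice. An operator $S:E\to X$ from a Banach space to a Banach lattice is $(p,\infty)$-convex if there is a constant $K$ with $\|\bigvee_{k=1}^n|Sx_k|\|\le K(\sum_{k=1}^n\|x_k\|^p)^{1/p}$ for all $x_1,\dots,x_n\in E$; the least such $K$ is $K^{(p,\infty)}(S)$. *)

(* Defs.v *)
From HB Require Import structures.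
From mathcomp Require Import all_boot all_order all_algebra.
From mathcomp Require Import all_classical all_reals all_analysis.
From mathcomp Require Import measurable_realfun ring.
Set Implicit Arguments.
Unset Strict Implicit.
Unset Printing Implicit Defensive.
Import Order.TTheory GRing.Theory Num.Theory.
Import numFieldNormedType.Exports.
Local Open Scope classical_set_scope.
Local Open Scope ring_scope.

(* The lattice operations are not inherited from Order.Lattice: Num.RealDomain is
   the only structure of the hierarchy above both an additive structure and
   Order.MeetSemilattice, so Hierarchy Builder rejects another such join. *)
HB.mixin Record NormedModule_isNormedLattice (R : numDomainType) (V : Type)
    & NormedModule R V := {
  lle : V -> V -> Prop ;
  ljoin : V -> V -> V ;
  lmeet : V -> V -> V ;
  lle_refl : forall x : V, lle x x ;
  lle_anti : forall x y : V, lle x y -> lle y x -> x = y ;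
  lle_trans : forall y x z : V, lle x y -> lle y z -> lle x z ;
  ljoinP : forall x y z : V, lle (ljoin x y) z <-> lle x z /\ lle y z ;
  lmeetP : forall x y z : V, lle z (lmeet x y) <-> lle z x /\ lle z y ;
  lle_add2r : forall z x y : V, lle x y -> lle (x + z) (y + z) ;
  lle_scale : forall (a : R) (x y : V),
    0 <= a -> lle x y -> lle (a *: x) (a *: y) ;
  lle_norm : forall x y : V, lle (ljoin x (- x)) (ljoin y (- y)) -> `|x| <= `|y|
}.

#[short(type="normedLatticeType")]
HB.structure Definition NormedLattice (R : numDomainType) :=
  {V of NormedModule R V & NormedModule_isNormedLattice R V}.

#[short(type="banachLatticeType")]
HB.structure Definition BanachLattice (R : numFieldType) :=
  {V of NormedLattice R V & Complete V}.

Section weak_Lp.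
Context {d : measure_display} {T : measurableType d} {R : realType}.
Variables (mu : {measure set T -> \bar R}) (p : R).
Implicit Types f g : T -> R.

Definition weak_qnorm f : \bar R :=
  ((ereal_sup [set (t `^ p)%:E * mu [set x | (t < `|f x|)%R]
    | t in [set t : R | (0 < t)%R]]) `^ p^-1)%E.

(* The maximum with 0 only matters when no measurable set has positive finite
   measure, where ereal_sup set0 = -oo. *)
Definition weak_norm f : \bar R :=
  (maxe 0 (ereal_sup [set (fine (mu A) `^ (-1 + p^-1))%:E
                          * \int[mu]_(x in A) `|f x|%:E
    | A in [set A | measurable A /\ 0 < mu A < +oo]]))%E.

(* The proof of 1 < p is an argument so that the submodule instance can be
   inferred. *)
Definition weakLfun of 1 < p : {pred T -> R} :=
  mem [set f | measurable_fun setT f /\ (weak_qnorm f < +oo)%E].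

Hypothesis p1 : 1 < p.
Let p0 : 0 < p. Proof. exact: lt_trans p1. Qed.

Lemma weakLfunP f : reflect (measurable_fun setT f /\ (weak_qnorm f < +oo)%E)
  (f \in weakLfun p1).
Proof. by apply: (iffP idP); rewrite inE. Qed.

Lemma measurable_weak_level f (t : R) : measurable_fun setT f ->
  measurable [set x | t < `|f x|].
Proof.
move=> mf; have mn : measurable_fun setT (fun x => `|f x|).
  exact: measurableT_comp.
have := mn measurableT `]t, +oo[%classic (measurable_itv _).
by rewrite setTI; congr measurable; apply/seteqP; split => x /=;
  rewrite in_itv/= andbT.
Qed.

Lemma weak_qnorm_fin f : (weak_qnorm f < +oo)%E <->
  exists M : R, 0 <= M /\
    forall t : R, 0 < t -> ((t `^ p)%:E * mu [set x | (t < `|f x|)%R] <= M%:E)%E.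
Proof.
rewrite /weak_qnorm; set s := ereal_sup _.
have s0 : (0 <= s)%E.
  apply: (@le_trans _ _ ((1 `^ p)%:E * mu [set x | (1 < `|f x|)%R])%E).
    by rewrite mule_ge0// lee_fin powR_ge0.
  by apply: ereal_sup_ubound; exists 1 => //=.
split=> [fin|[M [M0 hM]]].
  have sfin : (s < +oo)%E by apply: (lty_poweRy _ fin); rewrite invr_eq0 gt_eqF.
  have sf : s \is a fin_num by rewrite ge0_fin_numE.
  exists (fine s); split; first exact: fine_ge0.
  move=> t t0; rewrite fineK//; apply: ereal_sup_ubound; by exists t.
apply: poweR_lty.
apply: (@le_lt_trans _ _ M%:E); last exact: ltry.
by apply: ge_ereal_sup => _ [t /= t0 <-]; exact: hM.
Qed.

Lemma weakLfun_submod_closed : submod_closed (weakLfun p1).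
Proof.
split.
  apply/weakLfunP; split; first exact: measurable_cst.
  apply/weak_qnorm_fin; exists 0; split=> // t t0.
  rewrite (_ : [set x | _] = set0) ?measure0 ?mule0//.
  by apply/seteqP; split => x //=; rewrite normr0 ltNge ltW.
move=> a f g /weakLfunP[mf /weak_qnorm_fin[M [M0 hM]]].
move=> /weakLfunP[mg /weak_qnorm_fin[N [N0 hN]]]; apply/weakLfunP.
have mh : measurable_fun setT (a *: f + g).
  apply: measurable_funD => //; exact: measurable_funM.
split=> //; apply/weak_qnorm_fin.
set b := `|a| + 1; have b0 : 0 < b by rewrite ltr_wpDl.
exists ((2 * b) `^ p * M + 2 `^ p * N); split.
  by rewrite addr_ge0// mulr_ge0// powR_ge0.
move=> t t0.
have t2 : 0 < t / (2 * b) by rewrite divr_gt0// mulr_gt0.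
have t3 : 0 < t / 2 by rewrite divr_gt0.
apply: (@le_trans _ _ ((t `^ p)%:E * (mu [set x | (t / (2 * b) < `|f x|)%R]
   + mu [set x | (t / 2 < `|g x|)%R]))%E).
  apply: lee_wpmul2l; first by rewrite lee_fin powR_ge0.
  apply: (le_trans _ (measureU2 mu _ _)); try exact: measurable_weak_level.
  apply: le_measure; rewrite ?inE; try exact: measurable_weak_level.
    by apply: measurableU; exact: measurable_weak_level.
  move=> x /= tx; apply: contrapT => /not_orP[].
  move=> /negP; rewrite -leNgt => fx /negP; rewrite -leNgt => gx.
  move: tx; rewrite ltNge; apply/negP; rewrite negbK.
  rewrite (le_trans (ler_normD _ _))// [leRHS](splitr t) lerD//.
  rewrite normrZ.
  apply: (@le_trans _ _ (b * (t / (2 * b)))).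
    by apply: ler_pM => //; rewrite /b lerDl.
  have -> // : b * (t / (2 * b)) = t / 2 by field; rewrite gt_eqF.
rewrite ge0_muleDr// EFinD leeD//.
  have -> : (t `^ p = (2 * b) `^ p * (t / (2 * b)) `^ p)%R.
    rewrite -powRM ?(ltW t2) ?mulr_ge0 ?(ltW b0)//; congr (_ `^ p).
    by rewrite mulrCA divff ?mulr1// gt_eqF// mulr_gt0.
  by rewrite !EFinM -muleA lee_wpmul2l ?lee_fin ?powR_ge0//; exact: hM.
have -> : (t `^ p = 2 `^ p * (t / 2) `^ p)%R.
  rewrite -powRM ?(ltW t3)//; congr (_ `^ p).
  by rewrite mulrCA divff ?mulr1.
by rewrite !EFinM -muleA lee_wpmul2l ?lee_fin ?powR_ge0//; exact: hN.
Qed.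

Lemma dyadic_bound (a s : R) : 0 < s ->
  (a%:E <= s%:E + \sum_(0 <= k <oo) ((s * 2 ^+ k) * (s * 2 ^+ k < a)%R%:R)%R%:E)%E.
Proof.
move=> s0.
have exN : exists n, a <= s * 2 ^+ n.
  exists (Num.bound `|a / s|); rewrite -ler_pdivrMl// mulrC.
  rewrite (le_trans (ler_norm _))// (le_trans (ltW (archi_boundP _)))//.
  by rewrite -natrX ler_nat; apply: ltnW; exact: ltn_expl.
have [N aN minN] := find_ex_minn exN.
apply: (@le_trans _ _ (s%:E +
    \sum_(0 <= k < N) ((s * 2 ^+ k) * (s * 2 ^+ k < a)%R%:R)%R%:E)%E); last first.
  rewrite leeD2l//; apply: nneseries_lim_ge => k _ _.
  by rewrite lee_fin mulr_ge0// mulr_ge0 ?exprn_ge0// ltW.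
rewrite sumEFin -EFinD lee_fin.
rewrite (_ : \sum_(_ <= _ < _) _ = s * 2 ^+ N - s); first by rewrite addrC subrK.
rewrite big_mkord (eq_bigr (fun k : 'I_N => s * 2 ^+ k)); last first.
  move=> k _; suff -> : s * 2 ^+ k < a by rewrite mulr1.
  rewrite ltNge; apply/negP => /minN; by rewrite leqNgt ltn_ord.
elim: (N) => [|n IH]; first by rewrite big_ord0 expr0 mulr1 subrr.
by rewrite big_ord_recr/= IH exprS; ring.
Qed.

Lemma nneseries_geometric_le (m r : R) : 0 <= m -> 0 <= r < 1 ->
  (\sum_(0 <= k <oo) (m * r ^+ k)%:E <= (m / (1 - r))%:E)%E.
Proof.
move=> m0 /andP[r0 r1]; apply: lime_le.
  by apply: is_cvg_nneseries => n _ _; rewrite lee_fin mulr_ge0// exprn_ge0.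
apply: nearW => n; rewrite sumEFin lee_fin.
have := @geometric_seriesE R m r; rewrite lt_eqF// => /(_ isT).
move/(congr1 (fun u => u n)); rewrite /series/= => ->.
rewrite ler_wpM2r ?invr_ge0 ?subr_ge0 ?(ltW r1)//.
by rewrite ler_piMr// gerBl exprn_ge0.
Qed.

Lemma integral_weak_le f (M s : R) (A : set T) : measurable_fun setT f ->
  0 <= M -> 0 < s -> measurable A ->
  (forall t : R, 0 < t -> ((t `^ p)%:E * mu [set x | (t < `|f x|)%R] <= M%:E)%E) ->
  (\int[mu]_(x in A) `|f x|%:E <=
    s%:E * mu A + (s `^ (1 - p) * M / (1 - 2 `^ (1 - p)))%:E)%E.
Proof.
move=> mf M0 s0 mA hM.
pose c k := s * 2 ^+ k; have c0 k : 0 < c k by rewrite mulr_gt0 ?exprn_gt0.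
pose B k := [set x | (c k < `|f x|)%R].
have mB k : measurable (B k) by exact: measurable_weak_level.
pose g k x := (c k * \1_(B k) x)%:E.
have g0 k x : (0 <= g k x)%E by rewrite lee_fin mulr_ge0// ltW.
have mg k : measurable_fun A (g k).
  by apply/measurable_EFinP/measurable_funM => //; exact: measurable_indic.
have ms : measurable_fun A (fun x => \sum_(0 <= k <oo) g k x)%E.
  by apply: ge0_emeasurable_sum => // k x _ _; exact: g0.
apply: (@le_trans _ _ (\int[mu]_(x in A) (s%:E + \sum_(0 <= k <oo) g k x))%E).
  apply: ge0_le_integral => //.
  - apply/measurable_EFinP; apply: measurableT_comp => //.
    exact: measurable_funTS.
  - exact: emeasurable_funD.
  - move=> x _; have := dyadic_bound `|f x| s0.
    rewrite [X in (_ <= _ + X)%E -> _](_ : _ = \sum_(0 <= k <oo) g k x)%E//.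
    apply: eq_eseriesr => k _; rewrite /g indicE; congr (_ * (nat_of_bool _)%:R)%:E.
    by symmetry; exact: asboolb.
rewrite ge0_integralD//; last 2 first.
  - by move=> x _; rewrite lee_fin ltW.
  - by move=> x _; apply: nneseries_ge0 => k _ _; exact: g0.
rewrite integral_cst// leeD2l// integral_nneseries//.
have r01 : 0 <= (2 : R) `^ (1 - p) < 1.
  rewrite powR_ge0/= /powR pnatr_eq0/= -[ltRHS]expR0 ltr_expR.
  by rewrite nmulr_rlt0 ?subr_lt0// ln_gt0// ltr1n.
apply: le_trans (nneseries_geometric_le _ r01); last first.
  by rewrite mulr_ge0// powR_ge0.
apply: lee_nneseries => [k _ _|k _].
  by apply: integral_ge0 => x _; exact: g0.
under eq_integral do rewrite /g EFinM.
rewrite ge0_integralZl_EFin//; last 2 first.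
  - by apply/measurable_EFinP; exact: measurable_indic.
  - exact: ltW.
rewrite integral_indic//.
apply: (@le_trans _ _ ((c k)%:E * mu (B k))%E).
  rewrite lee_wpmul2l// ?lee_fin ?(ltW (c0 k))//.
  by apply: le_measure; rewrite ?inE//; exact: measurableI.
have -> : c k = (c k `^ (1 - p)) * (c k `^ p).
  by rewrite -powRD ?subrK ?powRr1 ?(ltW (c0 k))// oner_eq0.
rewrite EFinM -muleA.
apply: (@le_trans _ _ ((c k `^ (1 - p))%:E * M%:E)%E).
  by rewrite lee_wpmul2l// ?lee_fin ?powR_ge0//; exact: hM.
rewrite -EFinM lee_fin /c powRM ?exprn_ge0 ?(ltW s0)//.
rewrite -powR_mulrn// -powRrM (mulrC k%:R) powRrM powR_mulrn ?powR_ge0//.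
by rewrite mulrAC.
Qed.

Lemma weak_norm_ge0 f : (0 <= weak_norm f)%E.
Proof. by rewrite /weak_norm le_max lexx. Qed.

Lemma weak_norm_ub f A : measurable A -> (0 < mu A < +oo)%E ->
  ((fine (mu A) `^ (-1 + p^-1))%:E * \int[mu]_(x in A) `|f x|%:E
    <= weak_norm f)%E.
Proof.
move=> mA A0; rewrite /weak_norm le_max; apply/orP; right.
by apply: ereal_sup_ubound; exists A.
Qed.

Lemma weak_norm_lub f (M : \bar R) : (0 <= M)%E ->
  (forall A, measurable A -> (0 < mu A < +oo)%E ->
    ((fine (mu A) `^ (-1 + p^-1))%:E * \int[mu]_(x in A) `|f x|%:E <= M)%E) ->
  (weak_norm f <= M)%E.
Proof.
move=> M0 h; rewrite /weak_norm ge_max M0/=.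
by apply: ge_ereal_sup => _ [A /= [mA A0] <-]; exact: h.
Qed.

Lemma weak_norm_fin f : f \in weakLfun p1 -> weak_norm f \is a fin_num.
Proof.
move=> /weakLfunP[mf /weak_qnorm_fin[M [M0 hM]]].
rewrite ge0_fin_numE ?weak_norm_ge0//.
pose K := 1 + M / (1 - 2 `^ (1 - p)).
suff : (weak_norm f <= (Num.max 0 K)%:E)%E.
  by move=> /le_lt_trans; apply; exact: ltry.
apply: weak_norm_lub; first by rewrite lee_fin le_max lexx.
move=> A mA /andP[A0 Aoo]; pose m := fine (mu A).
have muA : mu A = m%:E by rewrite fineK// ge0_fin_numE.
have m0 : 0 < m by rewrite -lte_fin -muA.
pose s := m `^ (- p^-1); have s0 : 0 < s by exact: powR_gt0.
apply: (@le_trans _ _ ((m `^ (-1 + p^-1))%:E *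
    (s%:E * mu A + (s `^ (1 - p) * M / (1 - 2 `^ (1 - p)))%:E))%E).
  by rewrite lee_wpmul2l ?lee_fin ?powR_ge0//; exact: integral_weak_le.
rewrite muA -(EFinM s) -EFinD -EFinM lee_fin le_max; apply/orP; right.
have pN0 : p != 0 by rewrite gt_eqF.
have mD a b : m `^ a * m `^ b = m `^ (a + b).
  by rewrite powRD// (gt_eqF m0) implybT.
have e1 : m `^ (-1 + p^-1) * (s * m) = 1.
  rewrite -[X in s * X]powRr1 ?(ltW m0)// !mD.
  rewrite (_ : _ + _ = 0) ?powRr0//; ring.
have e2 : m `^ (-1 + p^-1) * s `^ (1 - p) = 1.
  rewrite -powRrM mD (_ : _ + _ = 0) ?powRr0//.
  by field.
by rewrite mulrDr e1 /K -!mulrA (mulrA _ (s `^ _)) e2 mul1r.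
Qed.

Lemma weak_norm_le f g : measurable_fun setT f -> measurable_fun setT g ->
  {ae mu, forall x, `|f x| <= `|g x|} -> (weak_norm f <= weak_norm g)%E.
Proof.
move=> mf mg fg; apply: weak_norm_lub; first exact: weak_norm_ge0.
move=> A mA A0; apply: (le_trans _ (weak_norm_ub g mA A0)).
rewrite lee_wpmul2l ?lee_fin ?powR_ge0//; apply: ae_ge0_le_integral => //.
- by apply/measurable_EFinP; apply: measurableT_comp => //; exact: measurable_funTS.
- by apply/measurable_EFinP; apply: measurableT_comp => //; exact: measurable_funTS.
- by apply: filterS fg => x; rewrite lee_fin.
Qed.

Lemma weak_normD f g : measurable_fun setT f -> measurable_fun setT g ->
  (weak_norm (f + g)%R <= weak_norm f + weak_norm g)%E.
Proof.
move=> mf mg; apply: weak_norm_lub; first by rewrite adde_ge0// weak_norm_ge0.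
move=> A mA A0.
have nmf (h : T -> R) : measurable_fun setT h -> measurable_fun A (fun x => `|h x|%:E).
  by move=> mh; apply/measurable_EFinP; apply: measurableT_comp => //;
    exact: measurable_funTS.
apply: (@le_trans _ _ ((fine (mu A) `^ (-1 + p^-1))%:E *
    (\int[mu]_(x in A) `|f x|%:E + \int[mu]_(x in A) `|g x|%:E))%E).
  rewrite lee_wpmul2l ?lee_fin ?powR_ge0// -ge0_integralD//; try exact: nmf.
  apply: ge0_le_integral => //.
  - by apply: nmf; exact: measurable_funD.
  - by apply: emeasurable_funD; exact: nmf.
  - by move=> x _; rewrite -EFinD lee_fin; exact: ler_normD.
by rewrite ge0_muleDr ?integral_ge0// leeD//; exact: weak_norm_ub.
Qed.

Lemma weak_normZ_le a f : measurable_fun setT f ->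
  (weak_norm (a *: f)%R <= `|a|%:E * weak_norm f)%E.
Proof.
move=> mf; apply: weak_norm_lub.
  by rewrite mule_ge0// weak_norm_ge0.
move=> A mA A0.
rewrite (eq_integral (fun x => `|a|%:E * `|f x|%:E))%E; last first.
  by move=> x _; rewrite -EFinM -normrM.
rewrite ge0_integralZl_EFin//; last first.
  by apply/measurable_EFinP; apply: measurableT_comp => //; exact: measurable_funTS.
by rewrite muleCA lee_wpmul2l//; exact: weak_norm_ub.
Qed.

Lemma weak_normZ a f : measurable_fun setT f ->
  (weak_norm (a *: f)%R = `|a|%:E * weak_norm f)%E.
Proof.
move=> mf; apply/eqP; rewrite eq_le weak_normZ_le//=.
have [->|a0] := eqVneq a 0; first by rewrite normr0 mul0e weak_norm_ge0.
have maf : measurable_fun setT (a *: f) by exact: measurable_funM.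
have /(lee_wpmul2l (normr_ge0 a : (0 <= `|a|%:E)%E)) :=
  weak_normZ_le a^-1 maf.
by rewrite scalerA mulVf// scale1r muleA -EFinM -normrM divff// normr1 mul1e.
Qed.

Lemma weak_norm_eq0 f : f \in weakLfun p1 -> weak_norm f = 0%E ->
  {ae mu, forall x, f x = 0}.
Proof.
move=> /weakLfunP[mf /weak_qnorm_fin[M [M0 hM]]] f0.
pose B n := [set x | n.+1%:R^-1 < `|f x|].
have mB n : measurable (B n) by exact: measurable_weak_level.
have B0 n : mu (B n) = 0%E.
  apply/eqP; rewrite eq_le measure_ge0 andbT leNgt; apply/negP => Bn.
  have n0 : 0 < n.+1%:R^-1 :> R by rewrite invr_gt0.
  have Boo : (mu (B n) < +oo)%E.
    have := hM _ n0; rewrite -/(B n) => h.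
    rewrite ltey; apply/eqP => Boo; move: h.
    by rewrite Boo gt0_muley ?lte_fin ?powR_gt0// leye_eq.
  have mBfin : (0 < mu (B n) < +oo)%E by rewrite Bn.
  have := weak_norm_ub f (mB n) mBfin; rewrite f0 => h.
  have : ((fine (mu (B n)) `^ (-1 + p^-1))%:E * (n.+1%:R^-1%:E * mu (B n))
      <= 0)%E.
    apply: le_trans h; rewrite lee_wpmul2l ?lee_fin ?powR_ge0//.
    rewrite -integral_cst//; apply: ge0_le_integral => //.
    - by move=> x _; rewrite lee_fin.
    - by apply/measurable_EFinP; apply: measurableT_comp => //;
        exact: measurable_funTS.
    - by move=> x /ltW; rewrite lee_fin.
  apply/negP; rewrite -ltNge mule_gt0// ?mule_gt0// lte_fin powR_gt0//.
  by rewrite fine_gt0.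
have : mu.-negligible (\bigcup_n B n).
  by apply: negligible_bigcup => n; apply/negligibleP; [exact: mB|exact: B0].
apply: negligibleS => x /= /eqP; rewrite -normr_gt0 => fx.
exists (Num.bound `|f x|^-1) => //=; rewrite /B/=.
rewrite invf_plt ?posrE// (lt_trans (archi_boundP _))// ?invr_ge0//.
by rewrite ltr_nat.
Qed.

End weak_Lp.
Section weak_Lp_type.
Context {d : measure_display} {T : measurableType d} {R : realType}.
Variables (mu : {measure set T -> \bar R}) (p : R) (p1 : 1 < p).

HB.instance Definition _ := GRing.isSubmodClosed.Build R (T -> R)
  (weakLfun mu p1) (weakLfun_submod_closed mu p1).

Record weakLfunType := WeakLfun {
  weakLfun_val :> T -> R ;
  weakLfun_valP : weakLfun_val \in weakLfun mu p1
}.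

HB.instance Definition _ := [isSub for weakLfun_val].
HB.instance Definition _ := [Choice of weakLfunType by <:].
HB.instance Definition _ := [SubChoice_isSubLmodule of weakLfunType by <:].

Definition weak_ae_eq (f g : weakLfunType) : bool :=
  `[< {ae mu, forall x, f x = g x} >].

Lemma weak_ae_eq_equiv : equiv_class_of weak_ae_eq.
Proof.
split.
- by move=> f; apply/asboolP; apply: aeW.
- by move=> f g; apply/asboolP/asboolP; apply: filterS.
- move=> g f h /asboolP fg /asboolP gh; apply/asboolP.
  by apply: filterS2 fg gh => x -> ->.
Qed.

Canonical weak_ae_eq_equiv_rel := EquivRelPack weak_ae_eq_equiv.

Definition weakLp : Type := {eq_quot weak_ae_eq}%qT.
HB.instance Definition _ := Choice.on weakLp.
HB.instance Definition _ := EqQuotient.on weakLp.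

Definition weak_class (f : weakLfunType) : weakLp := \pi_weakLp%qT f.

Lemma weak_classP f g :
  weak_class f = weak_class g <-> {ae mu, forall x, f x = g x}.
Proof.
split=> [/eqP|fg]; first by rewrite piE => /asboolP.
by apply/eqP; rewrite piE; apply/asboolP.
Qed.

Lemma weak_reprK (f : weakLp) : weak_class (repr f) = f.
Proof. exact: reprK. Qed.

Lemma weak_repr f : {ae mu, forall x, repr (weak_class f) x = f x}.
Proof. by apply/weak_classP; rewrite weak_reprK. Qed.

Lemma weak_classW (P : weakLp -> Prop) : (forall f, P (weak_class f)) ->
  forall f, P f.
Proof. by move=> h f; rewrite -(weak_reprK f). Qed.

Definition weakLp_add (f g : weakLp) := weak_class (repr f + repr g).
Definition weakLp_opp (f : weakLp) := weak_class (- repr f).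
Definition weakLp_scale (a : R) (f : weakLp) := weak_class (a *: repr f).

Lemma weakLp_addE f g :
  weakLp_add (weak_class f) (weak_class g) = weak_class (f + g).
Proof.
apply/weak_classP; apply: filterS2 (weak_repr f) (weak_repr g) => x fx gx.
by rewrite /= fctE fx gx.
Qed.

Lemma weakLp_oppE f : weakLp_opp (weak_class f) = weak_class (- f).
Proof.
by apply/weak_classP; apply: filterS (weak_repr f) => x fx; rewrite /= fctE fx.
Qed.

Lemma weakLp_scaleE a f : weakLp_scale a (weak_class f) = weak_class (a *: f).
Proof.
by apply/weak_classP; apply: filterS (weak_repr f) => x fx; rewrite /= fctE fx.
Qed.

Lemma weakLp_addA : associative weakLp_add.
Proof.
elim/weak_classW=> f; elim/weak_classW=> g; elim/weak_classW=> h.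
by rewrite !weakLp_addE addrA.
Qed.

Lemma weakLp_addC : commutative weakLp_add.
Proof.
by elim/weak_classW=> f; elim/weak_classW=> g; rewrite !weakLp_addE addrC.
Qed.

Lemma weakLp_add0 : left_id (weak_class 0) weakLp_add.
Proof. by elim/weak_classW=> f; rewrite weakLp_addE add0r. Qed.

Lemma weakLp_addN : left_inverse (weak_class 0) weakLp_opp weakLp_add.
Proof. by elim/weak_classW=> f; rewrite weakLp_oppE weakLp_addE addNr. Qed.

HB.instance Definition _ :=
  GRing.isZmodule.Build weakLp weakLp_addA weakLp_addC weakLp_add0 weakLp_addN.

Lemma weakLp_scaleA a b f :
  weakLp_scale a (weakLp_scale b f) = weakLp_scale (a * b) f.
Proof. by elim/weak_classW: f => f; rewrite !weakLp_scaleE scalerA. Qed.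

Lemma weakLp_scale1 : left_id 1 weakLp_scale.
Proof. by elim/weak_classW=> f; rewrite weakLp_scaleE scale1r. Qed.

Lemma weakLp_scaleDr : right_distributive weakLp_scale +%R.
Proof.
move=> a; elim/weak_classW=> f; elim/weak_classW=> g.
by rewrite [_ + _]weakLp_addE !weakLp_scaleE [RHS]weakLp_addE scalerDr.
Qed.

Lemma weakLp_scaleDl f : {morph weakLp_scale^~ f : a b / a + b}.
Proof.
elim/weak_classW: f => f a b.
by rewrite !weakLp_scaleE [RHS]weakLp_addE scalerDl.
Qed.

HB.instance Definition _ := GRing.Zmodule_isLmodule.Build R weakLp
  weakLp_scaleA weakLp_scale1 weakLp_scaleDr weakLp_scaleDl.

Lemma weak_classD f g : weak_class (f + g) = weak_class f + weak_class g.
Proof. by rewrite [RHS]weakLp_addE. Qed.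

Lemma weak_classN f : weak_class (- f) = - weak_class f.
Proof. by rewrite [RHS]weakLp_oppE. Qed.

Lemma weak_classZ (a : R) f : weak_class (a *: f) = a *: weak_class f.
Proof. by rewrite [RHS]weakLp_scaleE. Qed.

(* The norm is the lattice norm weak_norm; the quasi-norm weak_qnorm is only used
   to decide membership. *)
Definition weakLp_norm (f : weakLp) : R := fine (weak_norm mu p (repr f)).

Lemma weakLfun_measurable (f : weakLfunType) : measurable_fun setT f.
Proof. by have /weakLfunP[] := weakLfun_valP f. Qed.

Lemma weakLp_normE f : weakLp_norm (weak_class f) = fine (weak_norm mu p f).
Proof.
congr fine; apply/eqP; rewrite eq_le; apply/andP; split;
  apply: weak_norm_le; try exact: weakLfun_measurable;
  by apply: filterS (weak_repr f) => x ->.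
Qed.

Lemma weakLp_normD f g : weakLp_norm (f + g) <= weakLp_norm f + weakLp_norm g.
Proof.
elim/weak_classW: f => f; elim/weak_classW: g => g.
rewrite -weak_classD !weakLp_normE -fineD; last 2 first.
  - exact: (weak_norm_fin (weakLfun_valP f)).
  - exact: (weak_norm_fin (weakLfun_valP g)).
apply: fine_le.
- exact: (weak_norm_fin (weakLfun_valP (f + g))).
- by rewrite fin_numD !(weak_norm_fin (weakLfun_valP _)).
- by apply: weak_normD; exact: weakLfun_measurable.
Qed.

Lemma weakLp_normZ (a : R) f : weakLp_norm (a *: f) = `|a| * weakLp_norm f.
Proof.
elim/weak_classW: f => f.
rewrite -weak_classZ !weakLp_normE.
have -> : weak_norm mu p (a *: f) = (`|a|%:E * weak_norm mu p f)%E.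
  exact: weak_normZ (weakLfun_measurable f).
by rewrite fineM// (weak_norm_fin (weakLfun_valP f)).
Qed.

Lemma weakLp_norm0_eq0 f : weakLp_norm f = 0 -> f = 0.
Proof.
elim/weak_classW: f => f; rewrite weakLp_normE => f0.
apply/weak_classP; apply: (weak_norm_eq0 (weakLfun_valP f)).
by rewrite -(fineK (weak_norm_fin (weakLfun_valP f))) f0.
Qed.

HB.instance Definition _ := Lmodule_isNormed.Build R weakLp
  weakLp_normD weakLp_normZ weakLp_norm0_eq0.

Lemma weakLfun_select (f g : weakLfunType) (h : T -> R) :
  measurable_fun setT h -> (forall x, h x = f x \/ h x = g x) ->
  h \in weakLfun mu p1.
Proof.
move=> mh hfg; apply/weakLfunP; split=> //; apply/weak_qnorm_fin => //.
have /weakLfunP[mf /(weak_qnorm_fin _ p1)[M [M0 hM]]] := weakLfun_valP f.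
have /weakLfunP[mg /(weak_qnorm_fin _ p1)[N [N0 hN]]] := weakLfun_valP g.
exists (M + N); split; first exact: addr_ge0.
move=> t t0; apply: (@le_trans _ _ ((t `^ p)%:E * (mu [set x | (t < `|f x|)%R]
   + mu [set x | (t < `|g x|)%R]))%E).
  apply: lee_wpmul2l; first by rewrite lee_fin powR_ge0.
  apply: (le_trans _ (measureU2 mu _ _)); try exact: measurable_weak_level.
  apply: le_measure; rewrite ?inE; try exact: measurable_weak_level.
    by apply: measurableU; exact: measurable_weak_level.
  by move=> x /=; have [->|->] := hfg x; [left|right].
by rewrite ge0_muleDr// EFinD leeD// ?hM// hN.
Qed.

Lemma weakLfun_max (f g : weakLfunType) :
  (fun x => Num.max (f x) (g x)) \in weakLfun mu p1.
Proof.
apply: (@weakLfun_select f g).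
  exact: measurable_maxr (weakLfun_measurable f) (weakLfun_measurable g).
by move=> x; rewrite /Num.max; case: ifP; [right|left].
Qed.

Lemma weakLfun_min (f g : weakLfunType) :
  (fun x => Num.min (f x) (g x)) \in weakLfun mu p1.
Proof.
apply: (@weakLfun_select f g).
  exact: measurable_minr (weakLfun_measurable f) (weakLfun_measurable g).
by move=> x; rewrite /Num.min; case: ifP; [left|right].
Qed.

Definition weakLp_le (f g : weakLp) : Prop :=
  {ae mu, forall x, repr f x <= repr g x}.
Definition weakLp_join (f g : weakLp) : weakLp :=
  weak_class (WeakLfun (weakLfun_max (repr f) (repr g))).
Definition weakLp_meet (f g : weakLp) : weakLp :=
  weak_class (WeakLfun (weakLfun_min (repr f) (repr g))).

Lemma weakLp_leE f g : weakLp_le (weak_class f) (weak_class g) <->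
  {ae mu, forall x, f x <= g x}.
Proof.
split; apply: filterS3 (weak_repr f) (weak_repr g) => x -> ->; exact.
Qed.

Lemma weakLp_joinE f g : weakLp_join (weak_class f) (weak_class g) =
  weak_class (WeakLfun (weakLfun_max f g)).
Proof.
by apply/weak_classP; apply: filterS2 (weak_repr f) (weak_repr g) => x /= -> ->.
Qed.

Lemma weakLp_meetE f g : weakLp_meet (weak_class f) (weak_class g) =
  weak_class (WeakLfun (weakLfun_min f g)).
Proof.
by apply/weak_classP; apply: filterS2 (weak_repr f) (weak_repr g) => x /= -> ->.
Qed.

Lemma weakLp_le_refl f : weakLp_le f f.
Proof. by apply: aeW => x. Qed.

Lemma weakLp_le_anti f g : weakLp_le f g -> weakLp_le g f -> f = g.
Proof.
rewrite -[f]weak_reprK -[g]weak_reprK => /weakLp_leE fg /weakLp_leE gf.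
by apply/weak_classP; apply: filterS2 fg gf => x xy yx; apply/le_anti/andP.
Qed.

Lemma weakLp_le_trans g f h : weakLp_le f g -> weakLp_le g h -> weakLp_le f h.
Proof. by apply: filterS2 => x; exact: le_trans. Qed.

Lemma weakLp_joinP f g h :
  weakLp_le (weakLp_join f g) h <-> weakLp_le f h /\ weakLp_le g h.
Proof.
elim/weak_classW: f => f; elim/weak_classW: g => g; elim/weak_classW: h => h.
rewrite weakLp_joinE !weakLp_leE; split=> [fgh|[]].
  by split; apply: filterS fgh => x /=; rewrite ge_max => /andP[].
by apply: filterS2 => x /= fh gh; rewrite ge_max fh.
Qed.

Lemma weakLp_meetP f g h :
  weakLp_le h (weakLp_meet f g) <-> weakLp_le h f /\ weakLp_le h g.
Proof.
elim/weak_classW: f => f; elim/weak_classW: g => g; elim/weak_classW: h => h.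
rewrite weakLp_meetE !weakLp_leE; split=> [fgh|[]].
  by split; apply: filterS fgh => x /=; rewrite le_min => /andP[].
by apply: filterS2 => x /= fh gh; rewrite le_min fh.
Qed.

Lemma weakLp_le_add2r (h f g : weakLp) :
  weakLp_le f g -> weakLp_le (f + h) (g + h).
Proof.
elim/weak_classW: f => f; elim/weak_classW: g => g; elim/weak_classW: h => h.
rewrite -!weak_classD !weakLp_leE; apply: filterS => x fg.
by rewrite /= !fctE lerD2r.
Qed.

Lemma weakLp_le_scale (a : R) (f g : weakLp) :
  0 <= a -> weakLp_le f g -> weakLp_le (a *: f) (a *: g).
Proof.
elim/weak_classW: f => f; elim/weak_classW: g => g a0.
rewrite -!weak_classZ !weakLp_leE; apply: filterS => x fg.
by rewrite /= !fctE ler_wpM2l.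
Qed.

Lemma weakLp_le_norm (f g : weakLp) :
  weakLp_le (weakLp_join f (- f)) (weakLp_join g (- g)) -> `|f| <= `|g|.
Proof.
elim/weak_classW: f => f; elim/weak_classW: g => g.
rewrite -!weak_classN !weakLp_joinE weakLp_leE => fg.
rewrite [leLHS]weakLp_normE [leRHS]weakLp_normE; apply: fine_le.
- exact: (weak_norm_fin (weakLfun_valP f)).
- exact: (weak_norm_fin (weakLfun_valP g)).
- apply: weak_norm_le; try exact: weakLfun_measurable.
  by apply: filterS fg => x /=; rewrite !fctE !maxrN.
Qed.

HB.instance Definition _ :=
  NormedModule_isNormedLattice.Build R weakLp weakLp_le_refl weakLp_le_anti
    weakLp_le_trans weakLp_joinP weakLp_meetP weakLp_le_add2r weakLp_le_scale
    weakLp_le_norm.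

End weak_Lp_type.
Section operators.
Context {R : realType}.

(* Only meaningful for bounded f, that is, when the set below has a supremum. *)
Definition opnorm (V W : normedModType R) (f : V -> W) : R :=
  sup [set `|f x| | x in [set x | `|x| <= 1]].

Definition lattice_hom (V W : normedLatticeType R) (f : {linear V -> W}) : Prop :=
  [/\ bounded_fun_norm f,
      {morph f : x y / ljoin x y >-> ljoin x y} &
      {morph f : x y / lmeet x y >-> lmeet x y}].

Definition sublattice (V : normedLatticeType R) (A : set V) : Prop :=
  [/\ A 0,
      forall (a : R) x y, A x -> A y -> A (a *: x + y),
      forall x y, A x -> A y -> A (ljoin x y) &
      forall x y, A x -> A y -> A (lmeet x y)].

Definition generates (V : normedLatticeType R) (A : set V) : Prop :=
  dense (smallest (@sublattice V) A).

Definition modulus (V : normedLatticeType R) (x : V) : V := ljoin x (- x).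

(* The iterated supremum starts from 0, which changes nothing for n > 0 since
   moduli are positive; for n = 0 the inequality is trivial. *)
Definition pinfty_convex_with (p : R) (V : normedModType R)
    (X : normedLatticeType R) (S : V -> X) (K : R) : Prop :=
  0 <= K /\ forall (n : nat) (x : 'I_n -> V),
    `| \big[@ljoin R X/0]_(k < n) modulus (S (x k)) |
      <= K * (\sum_(k < n) `|x k| `^ p) `^ p^-1.

Definition pinfty_convex (p : R) (V : normedModType R)
    (X : normedLatticeType R) (S : V -> X) : Prop :=
  exists K : R, pinfty_convex_with p S K.

Definition pinfty_convex_const (p : R) (V : normedModType R)
    (X : normedLatticeType R) (S : V -> X) : R :=
  inf [set K | pinfty_convex_with p S K].

End operators.

(* Main.v *)
(* Let G be the vector sublattice of Z x X generated by the pairs (i x, S x). It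
   suffices to show |y| <= gamma C K |z| for (z, y) in G: then the closure of G is
   the graph of S'.
   Fix (z, y) in G and a norming positive functional f for |y|. The element y is
   built from finitely many joins, and f splits into finitely many positive
   functionals g_j each of which respects these joins (if x is an element to be
   split on, Hahn-Banach for u |-> f (u^+) yields 0 <= g <= f with g (x^-) = 0 and
   (f - g) (x^+) = 0). So y only matters through the scalars g_j (S x), and no
   representation of X by functions is needed.
   The convexity of S bounds sum_j max_k |g_j (S x_k)| by K (sum_k |x_k|^p)^(1/p).
   As in Pisier's factorization theorem there are then weights w_j of total mass
   at most const(p) K for which x |-> (g_j (S x) / w_j)_j maps E into the weak L_p
   space of the atomic measure w with norm at most 2 K^(1/p). Its lattice
   extension to Z has coordinates h_j with w_j h_j z = g_j y, so
   |y| = sum_j w_j |h_j z|, which is an L_1 norm and hence dominated by the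
   weak L_p norm. *)

Require Import Defs.
From HB Require Import structures.
From mathcomp Require Import all_boot all_order all_algebra.
From mathcomp Require Import all_classical all_reals all_analysis.
From mathcomp Require Import ring lra.
Set Implicit Arguments.
Unset Strict Implicit.
Unset Printing Implicit Defensive.
Import Order.TTheory GRing.Theory Num.Theory.
Import numFieldNormedType.Exports.
Local Open Scope classical_set_scope.
Local Open Scope ring_scope.

(** * Hahn-Banach *)

Section hahn_banach.
Context {R : realType} {V : lmodType R}.
Implicit Types (q : V -> R) (u v : V).

(** Homogeneity is asked only as an inequality, which passes directly to infima; equality is
    recovered in [sublinearZ]. *)
Definition sublinear_functional q : Prop :=
  (forall u v, q (u + v) <= q u + q v) /\
  (forall (a : R) u, 0 <= a -> q (a *: u) <= a * q u).

Lemma sublinear0 q : sublinear_functional q -> q 0 = 0.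
Proof.
move=> [qD qZ]; apply/eqP; rewrite eq_le; apply/andP; split.
  by have := qZ 0 0 (lexx 0); rewrite scale0r mul0r.
by have := qD 0 0; rewrite addr0 lerDl.
Qed.

Lemma sublinear_geN q u : sublinear_functional q -> - q (- u) <= q u.
Proof.
move=> sq; have [qD _] := sq.
by rewrite -subr_ge0 opprK -(sublinear0 sq) -(subrr u) qD.
Qed.

Lemma sublinearZ q (a : R) u :
  sublinear_functional q -> 0 <= a -> q (a *: u) = a * q u.
Proof.
move=> sq; have [_ qZ] := sq; rewrite le_eqVlt => /orP[/eqP<-|a0].
  by rewrite scale0r mul0r (sublinear0 sq).
apply/eqP; rewrite eq_le qZ ?(ltW a0)//= -ler_pdivlMl//.
rewrite -[u in leLHS]scale1r -(@mulVf _ a) ?gt_eqF// -scalerA.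
by rewrite qZ// invr_ge0 ltW.
Qed.

(** For sublinear [q], a sublinear minorant whose value at [- v] is at most [- q v]; a linear
    functional below it must therefore agree with [q] at [v]. *)
Definition sublinear_shift q v u : R :=
  inf [set q (u + t *: v) - t * q v | t in [set t : R | 0 <= t]].

Lemma sublinear_shift_ub q v u (t : R) : sublinear_functional q -> 0 <= t ->
  sublinear_shift q v u <= q (u + t *: v) - t * q v.
Proof.
move=> sq t0; apply: ge_inf; last by exists t.
(* A lower bound, since [s * q v = q (s *: v) <= q (u + s *: v) + q (- u)]. *)
exists (- q (- u)) => _ [s /= s0 <-].
rewrite lerBrDr -lerBrDl -(sublinearZ v sq s0) opprK.
by have [qD _] := sq; rewrite -{1}(addKr u (s *: v)) addrC qD.
Qed.

Lemma sublinear_shift_lub q v u (x : R) :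
  (forall t, 0 <= t -> x <= q (u + t *: v) - t * q v) ->
  x <= sublinear_shift q v u.
Proof.
move=> h; apply: lb_le_inf; first by exists (q (u + 0 *: v) - 0 * q v); exists 0 => /=.
by move=> _ [t /= t0 <-]; exact: h.
Qed.

Lemma sublinear_shift_le q v u :
  sublinear_functional q -> sublinear_shift q v u <= q u.
Proof.
move=> sq; apply: le_trans (sublinear_shift_ub v u sq (lexx 0)) _.
by rewrite scale0r addr0 mul0r subr0.
Qed.

Lemma sublinear_shiftN q v :
  sublinear_functional q -> sublinear_shift q v (- v) <= - q v.
Proof.
move=> sq; apply: le_trans (sublinear_shift_ub v _ sq ler01) _.
by rewrite scale1r addNr sublinear0// mul1r sub0r.
Qed.

Lemma sublinear_shift_sublinear q v :
  sublinear_functional q -> sublinear_functional (sublinear_shift q v).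
Proof.
move=> sq; have [qD qZ] := sq; split=> [u u'|a u].
  rewrite -lerBlDr; apply: sublinear_shift_lub => t t0; rewrite lerBlDr -lerBlDl.
  apply: sublinear_shift_lub => s s0; rewrite lerBlDl.
  apply: le_trans (sublinear_shift_ub v _ sq (addr_ge0 t0 s0)) _.
  have := qD (u + t *: v) (u' + s *: v); rewrite addrACA -scalerDl; lra.
rewrite le_eqVlt => /orP[/eqP<-|a0].
  by rewrite scale0r mul0r (le_trans (sublinear_shift_le _ _ sq))// sublinear0.
rewrite -ler_pdivrMl//; apply: sublinear_shift_lub => t t0.
rewrite ler_pdivrMl//.
apply: le_trans (sublinear_shift_ub v _ sq (mulr_ge0 (ltW a0) t0)) _.
rewrite -scalerA -scalerDr sublinearZ ?(ltW a0)//; lra.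
Qed.

(** Zorn's lemma for the reversed pointwise order. The pointwise infimum of a chain is subadditive
    because any two members are comparable and the smaller one serves both arguments. *)
Lemma minimal_sublinear q : sublinear_functional q ->
  exists2 f, sublinear_functional f /\ (forall u, f u <= q u) &
    forall g, sublinear_functional g -> (forall u, g u <= f u) -> g = f.
Proof.
move=> sq; pose T := {f : V -> R | sublinear_functional f /\ forall u, f u <= q u}.
pose r (f g : T) : bool := `[< forall u, sval g u <= sval f u >].
have [||||[f [sf fq]] minf] := @Zorn T r.
- by move=> f; apply/asboolP.
- move=> f g h /asboolP fg /asboolP gh; apply/asboolP => u.
  exact: le_trans (gh u) (fg u).
- move=> [f Pf] [g Pg] /asboolP fg /asboolP gf; apply: eq_exist => /=.
  by apply/funext => u; apply/le_anti; rewrite fg gf.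
- move=> A totA; have [[f0 Af0]|A0] := pselect (A !=set0); last first.
    (* The empty chain is bounded by [q] itself. *)
    exists (exist _ q (conj sq (fun u => lexx (q u)))) => f Af.
    by exfalso; apply: A0; exists f.
  pose m u := inf [set sval f u | f in A].
  have mub (f : T) u : A f -> m u <= sval f u.
    move=> Af; apply: ge_inf; last by exists f.
    exists (- q (- u)) => _ [[g [sg gq]] /= Ag <-].
    by apply: le_trans (sublinear_geN u sg); rewrite lerN2.
  have mlub u (x : R) : (forall f : T, A f -> x <= sval f u) -> x <= m u.
    move=> h; apply: lb_le_inf; first by exists (sval f0 u); exists f0.
    by move=> _ [f Af <-]; exact: h.
  have sm : sublinear_functional m.
    split=> [u v|a u a0].
      rewrite -lerBlDr; apply: (mlub) => f Af; rewrite lerBlDr -lerBlDl.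
      apply: (mlub) => g Ag; rewrite lerBlDl.
      have [sf _] := svalP f; have [sg _] := svalP g.
      have [/asboolP fg|/asboolP gf] := totA _ _ Af Ag.
        apply: le_trans (mub g _ Ag) _; apply: le_trans (sg.1 _ _) _.
        by rewrite lerD2r.
      apply: le_trans (mub f _ Af) _; apply: le_trans (sf.1 _ _) _.
      by rewrite lerD2l.
    move: a0; rewrite le_eqVlt => /orP[/eqP<-|a0].
      apply: le_trans (mub f0 _ Af0) _; have [sf0 _] := svalP f0.
      by rewrite (le_trans (sf0.2 _ _ _))// !mul0r.
    rewrite -ler_pdivrMl//; apply: (mlub) => f Af; rewrite ler_pdivrMl//.
    apply: le_trans (mub f _ Af) _; have [sf _] := svalP f.
    exact: sf.2 (ltW a0).
  have mq u : m u <= q u by apply: le_trans (mub f0 u Af0) (proj2 (svalP f0) u).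
  by exists (exist _ m (conj sm mq)) => f Af; apply/asboolP => u; exact: mub.
exists f => // g sg gf.
have gq u : g u <= q u by exact: le_trans (gf u) (fq u).
by have /(congr1 sval) := minf (exist _ g (conj sg gq)) (introT (asboolP _) gf).
Qed.

(* A minimal sublinear functional is linear: it must coincide with each of its
   shifts, whence f (- v) = - f v. Shifting q along v0 first forces f v0 = q v0. *)
Lemma hahn_banach q v0 : sublinear_functional q ->
  exists f : {scalar V}, (forall u, f u <= q u) /\ f v0 = q v0.
Proof.
move=> sq; have ss := sublinear_shift_sublinear v0 sq.
have [f [sf fs] minf] := minimal_sublinear ss.
have fN v : f (- v) = - f v.
  have e := minf _ (sublinear_shift_sublinear v sf)
    (fun u => sublinear_shift_le v u sf).
  apply/eqP; rewrite eq_le; apply/andP; split.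
    by rewrite -{1}e; exact: sublinear_shiftN.
  by rewrite -lerN2 opprK; exact: sublinear_geN.
have fD u v : f (u + v) = f u + f v.
  apply/eqP; rewrite eq_le sf.1/= -lerBrDr -fN.
  by apply: le_trans (sf.1 _ _); rewrite addrK.
have lf : scalar f.
  move=> a u v; rewrite fD; congr (_ + _).
  have [a0|a0] := leP 0 a; first exact: sublinearZ.
  rewrite -[a *: u]opprK -scaleNr fN sublinearZ ?oppr_ge0 ?(ltW a0)//.
  by rewrite mulNr opprK.
pose F : {scalar V} :=
  HB.pack f (GRing.isLinear.Build R V R *%R f lf).
exists F; split=> [u|]; first exact: le_trans (fs u) (sublinear_shift_le _ _ sq).
apply/eqP; rewrite eq_le (le_trans (fs _) (sublinear_shift_le _ _ sq))/=.
by rewrite -lerN2 -fN (le_trans (fs _))// sublinear_shiftN.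
Qed.

End hahn_banach.

(** * Normed lattices and positive functionals *)

Section normed_lattice.
Context {R : realType} {X : normedLatticeType R}.
Implicit Types (x y z u v : X) (a : R).

Lemma lle_joinl x y : lle x (ljoin x y).
Proof. by have /ljoinP[] := lle_refl (ljoin x y). Qed.

Lemma lle_joinr x y : lle y (ljoin x y).
Proof. by have /ljoinP[] := lle_refl (ljoin x y). Qed.

Lemma ljoin_lub x y z : lle x z -> lle y z -> lle (ljoin x y) z.
Proof. by move=> xz yz; apply/ljoinP. Qed.

Lemma lmeet_glb x y z : lle z x -> lle z y -> lle z (lmeet x y).
Proof. by move=> xz yz; apply/lmeetP. Qed.

Lemma lle_meetl x y : lle (lmeet x y) x.
Proof. by have /lmeetP[] := lle_refl (lmeet x y). Qed.

Lemma lle_meetr x y : lle (lmeet x y) y.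
Proof. by have /lmeetP[] := lle_refl (lmeet x y). Qed.

Lemma ljoinC x y : ljoin x y = ljoin y x.
Proof.
by apply: lle_anti; apply: ljoin_lub; (exact: lle_joinl || exact: lle_joinr).
Qed.

Lemma ljoin_idl x y : lle y x -> ljoin x y = x.
Proof.
by move=> yx; apply: lle_anti; [apply: ljoin_lub => //; exact: lle_refl|exact: lle_joinl].
Qed.

Lemma lleD x y u v : lle x y -> lle u v -> lle (x + u) (y + v).
Proof.
move=> xy uv; apply: lle_trans _ _ _ (lle_add2r _ _ _ xy) _.
by rewrite ![y + _]addrC; exact: lle_add2r.
Qed.

Lemma sub_lle_ge0 x y : lle x y -> lle 0 (y - x).
Proof. by move=> h; rewrite -(subrr x); exact: lle_add2r. Qed.

Lemma lle_of_sub x y : lle 0 (y - x) -> lle x y.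
Proof. by move=> /(lle_add2r x); rewrite add0r subrK. Qed.

Lemma lle_opp x y : lle x y -> lle (- y) (- x).
Proof.
by move=> /sub_lle_ge0 h; apply: lle_of_sub; rewrite opprK addrC.
Qed.

Lemma ljoinDr z x y : ljoin (x + z) (y + z) = ljoin x y + z.
Proof.
apply: lle_anti.
  by apply: ljoin_lub; apply: lle_add2r;
    (exact: lle_joinl || exact: lle_joinr).
rewrite -[X in lle _ X](subrK z); apply: lle_add2r; apply: ljoin_lub.
  by rewrite -{1}(addrK z x); apply: lle_add2r; exact: lle_joinl.
by rewrite -{1}(addrK z y); apply: lle_add2r; exact: lle_joinr.
Qed.

Lemma ljoinZ a x y : 0 <= a -> ljoin (a *: x) (a *: y) = a *: ljoin x y.
Proof.
rewrite le_eqVlt => /orP[/eqP<-|a0].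
  by rewrite !scale0r; apply: ljoin_idl; exact: lle_refl.
have a0' := ltW a0; have b0 : 0 <= a^-1 by rewrite invr_ge0.
apply: lle_anti.
  by apply: ljoin_lub; apply: lle_scale => //;
    (exact: lle_joinl || exact: lle_joinr).
have aK w : w = a *: (a^-1 *: w) by rewrite scalerA mulfV ?scale1r ?gt_eqF.
have aK' w : w = a^-1 *: (a *: w) by rewrite scalerA mulVf ?scale1r ?gt_eqF.
rewrite [X in lle _ X]aK; apply: lle_scale => //; apply: ljoin_lub.
  by rewrite {1}[x]aK'; apply: lle_scale => //; exact: lle_joinl.
by rewrite {1}[y]aK'; apply: lle_scale => //; exact: lle_joinr.
Qed.

(** This identity reduces meets to sums and joins, so linear maps that respect joins also respect
    meets. *)
Lemma lmeetE x y : lmeet x y = x + y - ljoin x y.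
Proof.
apply: lle_anti.
  apply: lle_of_sub; rewrite addrAC; apply: sub_lle_ge0; apply: ljoin_lub; apply: lle_of_sub.
    rewrite addrAC [x + y]addrC addrK.
    by apply: sub_lle_ge0; exact: (lle_meetr x y).
  by rewrite addrAC addrK; apply: sub_lle_ge0; exact: (lle_meetl x y).
apply: lmeet_glb; apply: lle_of_sub; rewrite opprB addrCA.
  rewrite (_ : x - (x + y) = - y); last by rewrite opprD addrA subrr sub0r.
  by apply: sub_lle_ge0; exact: (lle_joinr x y).
rewrite (_ : y - (x + y) = - x); last by rewrite opprD addrCA subrr addr0.
by apply: sub_lle_ge0; exact: (lle_joinl x y).
Qed.

Definition lpos x : X := ljoin x 0.

Lemma lpos_ge0 x : lle 0 (lpos x).
Proof. exact: lle_joinr. Qed.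

Lemma lpos_id x : lle 0 x -> lpos x = x.
Proof. exact: ljoin_idl. Qed.

Lemma lpos_eq0 x : lle x 0 -> lpos x = 0.
Proof. by move=> x0; rewrite /lpos ljoinC ljoin_idl. Qed.

Lemma lposB x : lpos x - lpos (- x) = x.
Proof.
apply/eqP; rewrite subr_eq; apply/eqP.
by rewrite addrC /lpos -ljoinDr addNr add0r ljoinC.
Qed.

Lemma ljoin_lpos x y : ljoin x y = y + lpos (x - y).
Proof. by rewrite addrC /lpos -ljoinDr subrK add0r. Qed.

Lemma lposD x y : lle (lpos (x + y)) (lpos x + lpos y).
Proof.
apply: ljoin_lub; first by apply: lleD; exact: lle_joinl.
by rewrite -[X in lle X _](addr0 0); apply: lleD; exact: lpos_ge0.
Qed.

Lemma lposZ a x : 0 <= a -> lpos (a *: x) = a *: lpos x.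
Proof. by move=> a0; rewrite /lpos -ljoinZ// scaler0. Qed.

(** Both [x] and [- x] lie below the modulus; adding the two inequalities shows that twice the
    modulus is positive. *)
Lemma modulus_ge0 x : lle 0 (modulus x).
Proof.
have : lle 0 (modulus x + modulus x).
  rewrite -(subrr x); apply: lleD; [exact: lle_joinl|exact: lle_joinr].
rewrite -mulr2n -scaler_nat => /(lle_scale 2^-1).
rewrite scaler0 scalerA mulVf ?pnatr_eq0// scale1r; apply.
by rewrite invr_ge0.
Qed.

Lemma modulus_id x : lle 0 x -> modulus x = x.
Proof.
move=> x0; apply: ljoin_idl; apply: (lle_trans 0) => //.
by rewrite -(oppr0 X); exact: lle_opp.
Qed.

Lemma norm_modulus x : `|modulus x| = `|x|.
Proof.
by apply/le_anti/andP; split; apply: lle_norm;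
  rewrite -![ljoin _ (- _)]/(modulus _) (modulus_id (modulus_ge0 x)); exact: lle_refl.
Qed.

Lemma norm_le_modulus x y : lle (modulus x) y -> `|x| <= `|y|.
Proof.
move=> xy; apply: lle_norm; rewrite -![ljoin _ (- _)]/(modulus _).
by rewrite (modulus_id (lle_trans _ _ _ (modulus_ge0 x) xy)).
Qed.

Lemma norm_le_pos x y : lle 0 x -> lle x y -> `|x| <= `|y|.
Proof. by move=> x0 xy; apply: norm_le_modulus; rewrite modulus_id. Qed.

Lemma norm_lpos x : `|lpos x| <= `|x|.
Proof.
rewrite -[leRHS]norm_modulus; apply: norm_le_pos; first exact: lpos_ge0.
by apply: ljoin_lub; [exact: lle_joinl|exact: modulus_ge0].
Qed.

(** Continuity of joins, by which the closure of the graph inherits them. The difference is bounded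
    by a sum of moduli; the other sign follows by exchanging the two pairs. *)
Lemma norm_ljoinB x y u v : `|ljoin x y - ljoin u v| <= `|x - u| + `|y - v|.
Proof.
rewrite -(norm_modulus (x - u)) -(norm_modulus (y - v)).
apply: le_trans (ler_normD _ _); apply: norm_le_modulus.
have main x' y' u' v' : lle (ljoin x' y' - ljoin u' v')
    (modulus (x' - u') + modulus (y' - v')).
  apply: lle_of_sub; rewrite opprB addrA; apply: sub_lle_ge0; apply: ljoin_lub.
    rewrite -[X in lle X _](subrK u') -[X in lle (X + _) _]addr0.
    apply: lleD; last exact: lle_joinl.
    by apply: lleD; [exact: lle_joinl|exact: modulus_ge0].
  rewrite -[X in lle X _](subrK v') -[X in lle (X + _) _]add0r.
  apply: lleD; last exact: lle_joinr.
  by apply: lleD; [exact: modulus_ge0|exact: lle_joinl].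
have modN (w : X) : modulus (- w) = modulus w by rewrite /modulus opprK ljoinC.
apply: ljoin_lub => //; rewrite opprB.
by rewrite -(modN (x - u)) -(modN (y - v)) !opprB.
Qed.

End normed_lattice.

Section positive_functional.
Context {R : realType} {X : normedLatticeType R}.
Implicit Types (x y u v : X) (f : {scalar X}).

Definition positive_functional f : Prop := forall u, lle 0 u -> 0 <= f u.

(** [f] sees only one sign of [x], which is what lets a positive [f] turn a join into a maximum. *)
Definition definite_at f x : Prop := f (lpos x) = 0 \/ f (lpos (- x)) = 0.

Lemma positive_le f u v : positive_functional f -> lle u v -> f u <= f v.
Proof. by move=> f0 /sub_lle_ge0 uv; rewrite -subr_ge0 -linearB; exact: f0. Qed.

(** The join is both [v + lpos (u - v)] and [u + lpos (v - u)]. Definiteness removes one of the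
    positive parts, and positivity identifies the remaining value as the maximum. *)
Lemma definite_join f u v : positive_functional f -> definite_at f (u - v) ->
  f (ljoin u v) = Num.max (f u) (f v).
Proof.
move=> f0; case=> e.
  have fv : f (ljoin u v) = f v by rewrite ljoin_lpos linearD e; exact: addr0.
  by rewrite fv; symmetry; apply/max_idPr; rewrite -fv; exact/positive_le/lle_joinl.
have fu : f (ljoin u v) = f u.
  by rewrite ljoinC ljoin_lpos -opprB linearD e; exact: addr0.
by rewrite fu; symmetry; apply/max_idPl; rewrite -fu; exact/positive_le/lle_joinr.
Qed.

(** Hahn-Banach below the norm of [lpos u]. This domination forces positivity, as [lpos (- u) = 0]
    for positive [u]. *)
Lemma norming_functional y : exists f, [/\ positive_functional f,
  f (modulus y) = `|y| & forall u, f u <= `|u|].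
Proof.
have sq : sublinear_functional (fun u => `|lpos u|).
  split=> [u v|a u a0].
    apply: le_trans (ler_normD _ _); apply: norm_le_pos; first exact: lpos_ge0.
    exact: lposD.
  by rewrite lposZ// normrZ ger0_norm.
have [f [fle fy]] := hahn_banach (modulus y) sq; exists f; split.
- move=> u u0; rewrite -oppr_le0 -linearN.
  apply: le_trans (fle _) _; rewrite lpos_eq0 ?normr0//.
  by rewrite -(oppr0 X); exact: lle_opp.
- by rewrite fy lpos_id ?norm_modulus//; exact: modulus_ge0.
- by move=> u; apply: le_trans (fle _) (norm_lpos _).
Qed.

Lemma split_functional f x : positive_functional f ->
  exists f1 f2, [/\ positive_functional f1, positive_functional f2,
    forall u, f u = f1 u + f2 u, f1 (lpos (- x)) = 0 & f2 (lpos x) = 0].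
Proof.
move=> f0.
have sq : sublinear_functional (fun u => f (lpos u)).
  split=> [u v|a u a0]; first by rewrite -linearD; exact/positive_le/lposD.
  by rewrite lposZ// linearZ.
have [g [gle gx]] := hahn_banach x sq.
have g0 : positive_functional g.
  move=> u u0; rewrite -oppr_le0 -linearN.
  apply: le_trans (gle _) _; rewrite lpos_eq0 ?linear0//.
  by rewrite -(oppr0 X); exact: lle_opp.
have gf u : lle 0 u -> g u <= f u by move=> u0; rewrite -{2}(lpos_id u0).
(* From [g x = f (lpos x)] and [g (lpos x) <= f (lpos x)] it follows that [g (lpos (- x))] is at
   most 0. *)
have gE : g x = g (lpos x) - g (lpos (- x)) by rewrite -linearB lposB.
have e : g (lpos (- x)) = 0.
  have := gf _ (lpos_ge0 x); have := g0 _ (lpos_ge0 (- x)); lra.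
exists g, (f \- g : {scalar X}); split=> //.
- by move=> u u0; rewrite /= subr_ge0; exact: gf.
- by move=> u; rewrite /= addrC subrK.
- by rewrite /= -gx gE e subr0 subrr.
Qed.

(** Split along the head, then decompose both halves along the tail. Definiteness at the head
    survives: if a sum of positive functionals vanishes at a positive vector, so does each
    summand. *)
Lemma definite_decomposition (s : seq X) f : positive_functional f ->
  exists m (g : 'I_m -> {scalar X}),
    [/\ forall j, positive_functional (g j),
        forall u, f u = \sum_(j < m) g j u &
        forall j x, x \in s -> definite_at (g j) x].
Proof.
elim: s f => [|x s IH] f f0.
  exists 1, (fun=> f); split=> // u; by rewrite big_ord1.
have [f1 [f2 [p1 p2 fE n1 n2]]] := split_functional x f0.
have [m1 [g1 [g1_ge0 f1E g1s]]] := IH _ p1.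
have [m2 [g2 [g2_ge0 f2E g2s]]] := IH _ p2.
exists (m1 + m2)%N, (fun j => match fintype.split j with inl k => g1 k | inr k => g2 k end).
split.
- by move=> j; case: (fintype.split j).
- move=> u; rewrite fE f1E f2E big_split_ord; congr (_ + _); apply: eq_bigr => k _.
    by rewrite (unsplitK (inl k)).
  by rewrite (unsplitK (inr k)).
- move=> j y; case: (fintype.split j) => k; rewrite inE => /orP[/eqP->|];
    [|exact: g1s| |exact: g2s].
    right; apply/eqP; move/eqP: n1; rewrite f1E psumr_eq0 => [/allP/(_ k)|i _].
      by rewrite mem_index_enum => /(_ isT).
    by apply: g1_ge0; exact: lpos_ge0.
  left; apply/eqP; move/eqP: n2; rewrite f2E psumr_eq0 => [/allP/(_ k)|i _].
    by rewrite mem_index_enum => /(_ isT).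
  by apply: g2_ge0; exact: lpos_ge0.
Qed.

End positive_functional.

(** * Factorization through weak L_p *)

Section weak_factorization.
Context {R : realType}.

(** For t > 1, dividing t^p <= t + 1 <= 2t by t leaves t^(p-1) <= 2. *)
Lemma powR_bound (p t : R) : 1 < p -> 0 <= t -> t `^ p <= t + 1 ->
  t <= 2 `^ (p - 1)^-1.
Proof.
move=> p1 t0 tp; have q0 : 0 < p - 1 by rewrite subr_gt0.
have [t1|t1] := leP t 1.
  by rewrite (le_trans t1)// -[leLHS](powRr0 2) ler_powR ?ler1n// invr_ge0 ltW.
have t_gt0 : 0 < t by exact: lt_trans t1.
have -> : t = (t `^ (p - 1)) `^ (p - 1)^-1.
  by rewrite -powRrM divff ?gt_eqF// powRr1.
rewrite ge0_ler_powR ?nnegrE ?powR_ge0 ?invr_ge0 ?(ltW q0)//.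
have : t * t `^ (p - 1) <= t * 2.
  rewrite -{1}[t]powRr1// -powRD ?(gt_eqF t_gt0) ?implybT//.
  by rewrite addrC subrK; lra.
by rewrite ler_pM2l.
Qed.

(* The penalty K * sum |x|^p makes the supremum over s finite; a near-maximiser
   s supplies the density w_j = max_(x in s) |phi_j x| + e, because appending one
   more vector to s cannot increase the penalised value by more than e. *)
Lemma weak_density (p K : R) (E : normedModType R) (m : nat)
    (phi : 'I_m -> {scalar E}) : 1 < p -> 0 < K ->
  (forall s : seq E, \sum_(j < m) \big[Num.max/0]_(x <- s) `|phi j x| <=
     K * (\sum_(x <- s) `|x| `^ p) `^ p^-1) ->
  exists w : 'I_m -> R, [/\ forall j, 0 < w j,
    \sum_(j < m) w j <= K * (2 `^ (p - 1)^-1 + 1) &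
    forall (A : pred 'I_m) x, \sum_(j < m | A j) `|phi j x| <=
      \sum_(j < m | A j) w j + K * `|x| `^ p].
Proof.
move=> p1 K0 hK; have p0 : 0 < p by exact: lt_trans p1.
pose F (s : seq E) j : R := \big[Num.max/0]_(x <- s) `|phi j x|.
pose t (s : seq E) : R := (\sum_(x <- s) `|x| `^ p) `^ p^-1.
pose V (s : seq E) : R := \sum_(j < m) F s j - K * (\sum_(x <- s) `|x| `^ p).
have t0 s : 0 <= t s by exact: powR_ge0.
have tp s : t s `^ p = \sum_(x <- s) `|x| `^ p.
  rewrite /t -powRrM mulVf ?gt_eqF// powRr1//.
  by apply: sumr_ge0 => x _; exact: powR_ge0.
have F0 s j : 0 <= F s j.
  rewrite /F; elim/big_rec: _ => // x y _ y0; by rewrite le_max y0 orbT.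
(* This rests on t - t^p <= 1 for t >= 0. *)
have VK s : V s <= K.
  apply: (@le_trans _ _ (K * (t s - t s `^ p))).
    by rewrite /V -tp mulrBr lerB// /F; exact: hK.
  rewrite -[leRHS]mulr1 ler_pM2l//.
  have [t1|t1] := leP (t s) 1; first by have := powR_ge0 (t s) p; lra.
  have : t s <= t s `^ p; last by lra.
  by rewrite -{1}[t s]powRr1// ler_powR// ltW.
have supV : has_sup (range V).
  by split; [exists (V [::]), [::]|exists K => _ [s _ <-]].
have VD s : V s <= sup (range V) by apply: ub_le_sup; [exact: supV.2|exists s].
(* With this slack the [m] extra terms [e] add at most [K] to the total weight. *)
pose e := K / m.+1%:R; have e0 : 0 < e by rewrite divr_gt0.
have [_ [s _ <-] sV] := sup_adherent e0 supV.
have eK : e <= K by rewrite ler_pdivrMr// ler_peMr ?(ltW K0)// ler1n.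
have V0 : V [::] = 0.
  by rewrite /V big_nil mulr0 subr0 big1// => j _; rewrite /F big_nil.
(* Since [V [::] = 0], near-maximality gives [V s > - e >= - K], which with [hK] becomes t^p <= t +
   1 for t = [t s]. *)
have ts : t s <= 2 `^ (p - 1)^-1.
  apply: powR_bound => //; rewrite -(ler_pM2l K0) tp.
  have := VD [::]; rewrite V0 => V0'.
  have := hK s; rewrite -/(t s) => hs.
  have : - K < V s by lra.
  rewrite /V /F; lra.
exists (fun j => F s j + e); split.
- by move=> j; rewrite ltr_wpDl.
- rewrite big_split/= mulrDr mulr1 lerD//.
    by apply: le_trans (hK s) _; rewrite ler_pM2l.
  by rewrite sumr_const card_ord -mulr_natr /e mulrAC ler_pdivrMr// ler_pM2l// ler_nat.
- move=> A x.
  (* One index in [A] already provides a weight that absorbs the slack [e]; for empty [A] both sums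
     vanish. *)
  have [j0 Aj0|A0] := pickP A.
    have := VD (x :: s); rewrite /V big_cons => VDx.
    have step : \sum_(j < m) (F (x :: s) j - F s j) <= K * `|x| `^ p + e.
      by move: sV; rewrite sumrB /V; lra.
    have : \sum_(j < m | A j) (`|phi j x| - F s j) <= K * `|x| `^ p + e.
      apply: le_trans step; rewrite [leRHS](bigID A)/= -[leLHS]addr0 lerD//.
        apply: ler_sum => j _; rewrite lerD2r /F big_cons le_max lexx//.
      apply: sumr_ge0 => j _; rewrite subr_ge0 /F big_cons le_max lexx orbT//.
    have : e <= \sum_(j < m | A j) e.
      by rewrite (bigD1 j0)//= lerDl sumr_ge0// => j _; exact: ltW.
    by rewrite sumrB big_split/=; lra.
  by rewrite !big_pred0// add0r mulr_ge0 ?(ltW K0)// powR_ge0.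
Qed.

(** Homogeneity turns the additive bound into a linear one: rescale [x] so that the penalty term
    equals [W]. The two terms on the right are then equal, hence the factor 2. *)
Lemma weak_density_bound (p K W : R) (E : normedModType R) (g : E -> R) :
  1 < p -> 0 < K -> 0 < W ->
  (forall (c : R) x, 0 <= c -> g (c *: x) = c * g x) ->
  (forall x, g x <= W + K * `|x| `^ p) ->
  forall x, W `^ (-1 + p^-1) * g x <= 2 * K `^ p^-1 * `|x|.
Proof.
move=> p1 K0 W0 gZ gW x; have p0 : 0 < p by exact: lt_trans p1.
have [->|x0] := eqVneq x 0.
  by rewrite -(scale0r 0) gZ// mul0r mulr0 scale0r normr0 mulr0.
have {}x0 : 0 < `|x| by rewrite normr_gt0.
have rootK (a : R) : 0 < a -> (a `^ p^-1) `^ p = a.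
  by move=> a0; rewrite -powRrM mulVf ?gt_eqF// powRr1// ltW.
pose k := K `^ p^-1; pose o := W `^ p^-1.
have k0 : 0 < k by exact: powR_gt0.
have o0 : 0 < o by exact: powR_gt0.
have c0 : 0 < o / (k * `|x|) by rewrite divr_gt0// mulr_gt0.
have rK : K * (o / k) `^ p = W.
  rewrite -{1}(rootK _ K0) -/k -powRM ?divr_ge0 ?(ltW k0) ?(ltW o0)//.
  by rewrite mulrCA divff ?gt_eqF// mulr1 /o rootK.
have := gW ((o / (k * `|x|)) *: x); rewrite gZ ?(ltW c0)// normrZ gtr0_norm//.
rewrite (_ : o / (k * `|x|) * `|x| = o / k); last first.
  by field; rewrite !gt_eqF.
rewrite rK => h.
have -> : W `^ (-1 + p^-1) = o / W.
  rewrite powRD ?(gt_eqF W0) ?implybT// -/o mulrC powR_inv1// ltW//.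
have -> : o / W * g x = k * `|x| / W * (o / (k * `|x|) * g x).
  by field; rewrite !gt_eqF.
apply: (@le_trans _ _ (k * `|x| / W * (W + W))).
  by rewrite ler_pM2l// divr_gt0// mulr_gt0.
by rewrite le_eqVlt; apply/orP; left; apply/eqP; rewrite -/k; field; rewrite gt_eqF.
Qed.

End weak_factorization.

(** * Weak L_p over an atomic measure *)

Section atomic_measure.
Context {R : realType}.
Variables (w : nat -> {nonneg R}) (m : nat).

(** The atoms are the first [m] naturals. On [nat] every set is measurable, so measurability of
    functions is automatic. *)
Definition atomic_measure : set nat -> \bar R :=
  msum (fun k => mscale (w k) \d_k) m.

HB.instance Definition _ := Measure.on atomic_measure.

Lemma atomic_measureE (A : set nat) :
  atomic_measure A = (\sum_(k < m | (k : nat) \in A) (w k)%:num)%:E.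
Proof.
rewrite /atomic_measure /msum/= -sumEFin [RHS]big_mkcond/=; apply: eq_bigr => k _.
by rewrite /mscale/= diracE; case: ifP => _; rewrite ?mule1 ?mule0.
Qed.

Lemma atomic_measure_finite : fin_num_fun atomic_measure.
Proof. by move=> A mA; rewrite atomic_measureE. Qed.

HB.instance Definition _ :=
  Measure_isFinite.Build _ _ _ atomic_measure atomic_measure_finite.

Lemma integral_atomic_measure (f : nat -> R) (A : set nat) :
  (\int[atomic_measure]_(x in A) `|f x|%:E =
   (\sum_(k < m | (k : nat) \in A) (w k)%:num * `|f k|)%:E)%E.
Proof.
rewrite ge0_integral_measure_sum//= -sumEFin [RHS]big_mkcond/=.
apply: eq_bigr => k _; rewrite ge0_integral_mscale//= integral_dirac//= diracE.
by case: ifP => _; rewrite ?mul1e ?mul0e ?mule0.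
Qed.

(** A point of positive mass lies in no negligible set; hence classes in [weakLp] have well-defined
    values at such atoms. *)
Lemma ae_atomic_measure (P : nat -> Prop) (k : 'I_m) : 0 < (w k)%:num ->
  {ae atomic_measure, forall x, P x} -> P k.
Proof.
move=> wk [N [mN N0 PN]]; apply: contrapT => nPk; move: N0.
rewrite atomic_measureE => /eqP; rewrite eqe psumr_eq0// => /allP/(_ k).
rewrite mem_index_enum => /(_ isT)/implyP; rewrite (gt_eqF wk).
by move=> /(_ (mem_set (PN _ nPk))).
Qed.

Variables (p : R) (p1 : 1 < p).

Lemma atomic_weakLfun (f : nat -> R) : f \in weakLfun atomic_measure p1.
Proof.
apply/weakLfunP; split=> //; apply/weak_qnorm_fin => //.
(* The p-th moment of [f] controls all level sets, as in Markov's inequality. *)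
exists (\sum_(k < m) (w k)%:num * `|f k| `^ p); split.
  by apply: sumr_ge0 => k _; rewrite mulr_ge0// powR_ge0.
move=> t t0; rewrite [X in (_ * X <= _)%E]atomic_measureE -EFinM lee_fin mulr_sumr big_mkcond/=.
apply: ler_sum => k _; case: ifPn => [|_]; last by rewrite mulr_ge0// powR_ge0.
rewrite inE/= => tf; rewrite mulrC ler_wpM2l// ge0_ler_powR ?nnegrE ?(ltW t0)//.
  by rewrite ltW// (lt_trans _ p1).
exact: ltW.
Qed.

Definition atomic_class (f : nat -> R) : weakLp atomic_measure p1 :=
  weak_class (WeakLfun (atomic_weakLfun f)).

Lemma repr_weak_class (g : weakLfunType atomic_measure p1) (k : 'I_m) :
  0 < (w k)%:num -> repr (weak_class g) k = g k.
Proof.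
move=> wk; apply: (ae_atomic_measure (P := fun k => repr (weak_class g) k = g k)) => //.
exact: weak_repr.
Qed.

Lemma repr_weakP (a : R) (f g : weakLp atomic_measure p1) (k : 'I_m) :
  0 < (w k)%:num -> repr (a *: f + g) k = a * repr f k + repr g k.
Proof.
move=> wk; rewrite [_ + _]/(weak_class _) repr_weak_class//.
by change (repr (weak_class (a *: repr f)) k + repr g k = a * repr f k + repr g k);
  rewrite repr_weak_class.
Qed.

Lemma repr_weak_join (f g : weakLp atomic_measure p1) (k : 'I_m) :
  0 < (w k)%:num -> repr (ljoin f g) k = Num.max (repr f k) (repr g k).
Proof. by move=> wk; rewrite [ljoin _ _]/(weak_class _) repr_weak_class. Qed.

(** Measure and integral over a set depend only on the indices below [m] that it contains, so the
    weak norm can be tested on index subsets. *)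
Lemma norm_atomic_class (f : nat -> R) (M : R) : 0 <= M ->
  (forall A : pred 'I_m, 0 < \sum_(k < m | A k) (w k)%:num ->
    (\sum_(k < m | A k) (w k)%:num) `^ (-1 + p^-1) *
      \sum_(k < m | A k) (w k)%:num * `|f k| <= M) ->
  `|atomic_class f| <= M.
Proof.
move=> M0 h; rewrite [leLHS]weakLp_normE -lee_fin fineK; last first.
  exact: weak_norm_fin (atomic_weakLfun f).
apply: weak_norm_lub; first by rewrite lee_fin.
move=> A mA; rewrite integral_atomic_measure; move=> /andP[A0 _].
have muA := atomic_measureE A.
have c0 : 0 < \sum_(k < m | (k : nat) \in A) (w k)%:num by rewrite -lte_fin -muA.
have := h (fun k => (k : nat) \in A) c0; rewrite -lee_fin EFinM.
have fA : fine (atomic_measure A) = \sum_(k < m | (k : nat) \in A) (w k)%:num.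
  by rewrite muA.
by rewrite [fine _]fA.
Qed.

(** Testing the weak norm on the whole space dominates the L_1 norm. *)
Lemma atomic_norm_lower (f : weakLp atomic_measure p1) :
  0 < \sum_(k < m) (w k)%:num ->
  \sum_(k < m) (w k)%:num * `|repr f k| <=
    (\sum_(k < m) (w k)%:num) `^ (1 - p^-1) * `|f|.
Proof.
set W := \sum_(k < m) _ => W0.
have setTE (F : 'I_m -> R) :
    \sum_(k < m | (k : nat) \in [set: nat]) F k = \sum_(k < m) F k.
  by apply: eq_bigl => k; rewrite in_setT.
have muT : atomic_measure setT = W%:E by rewrite atomic_measureE setTE.
have := @weak_norm_ub _ _ _ atomic_measure p (repr f) setT measurableT.
rewrite integral_atomic_measure setTE [X in (_ < X < _)%E]muT lte_fin W0 ltry.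
rewrite [fine _](congr1 fine muT) => /(_ isT).
rewrite -EFinM -[X in (_ <= X)%E]fineK; last first.
  exact: weak_norm_fin (weakLfun_valP _).
rewrite lee_fin -[fine (weak_norm _ _ _)]/(`|f|) => h.
rewrite -ler_pdivrMl ?powR_gt0// -powRN opprB.
by rewrite addrC.
Qed.

End atomic_measure.

(** * Norms of bounded linear operators *)

Section operator_norm.
Context {R : realType} {V W : normedModType R}.
Implicit Types f : {linear V -> W}.

Lemma bounded_opnorm_set f : bounded_fun_norm f ->
  has_sup [set `|f x| | x in [set x | `|x| <= 1]].
Proof.
move=> /(_ 1)[M fM]; split; first by exists `|f 0|, 0; rewrite //= normr0.
by exists M => _ [x x1 <-]; exact: fM.
Qed.

Lemma opnorm_ge0 f : bounded_fun_norm f -> 0 <= opnorm f.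
Proof.
move=> /bounded_opnorm_set[_ ub]; apply: le_trans (normr_ge0 (f 0)) _.
by apply: ub_le_sup => //; exists 0; rewrite //= normr0.
Qed.

Lemma opnorm_ub f x : bounded_fun_norm f -> `|f x| <= opnorm f * `|x|.
Proof.
move=> bf; have [->|x0] := eqVneq x 0; first by rewrite linear0 !normr0 mulr0.
have {}x0 : 0 < `|x| by rewrite normr_gt0.
rewrite -ler_pdivrMr// mulrC -[X in X * _]gtr0_norm ?invr_gt0// -normrZ -linearZ.
have [_ ub] := bounded_opnorm_set bf; apply: ub_le_sup => //.
by exists (`|x|^-1 *: x) => //=; rewrite normrZ gtr0_norm ?invr_gt0// mulVf ?gt_eqF.
Qed.

Lemma opnorm_lub f (M : R) : 0 <= M -> (forall x, `|f x| <= M * `|x|) ->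
  bounded_fun_norm f /\ opnorm f <= M.
Proof.
move=> M0 fM; split=> [r|].
  by exists (M * r) => x xr; rewrite (le_trans (fM x))// ler_wpM2l.
apply: ge_sup; first by exists `|f 0|, 0; rewrite //= normr0.
by move=> _ [x x1 <-]; rewrite (le_trans (fM x))// -[leRHS]mulr1 ler_wpM2l.
Qed.

End operator_norm.

(** * Extension of finitely many functionals *)

Section weak_extension.
Context {R : realType} {p : R} (p1 : 1 < p).
Context {E : normedModType R} {Z : normedLatticeType R}.

(** Property (2) of the theorem. The sign of [C] is not prescribed, whence [Num.max C 0] in the
    estimates below. *)
Definition weak_extension (i : {linear E -> Z}) (C : R) : Prop :=
  forall (d : measure_display) (Omega : measurableType d)
     (mu : {finite_measure set Omega -> \bar R})
     (T : {linear E -> weakLp mu p1}),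
     bounded_fun_norm T ->
     exists T' : {linear Z -> weakLp mu p1},
       [/\ lattice_hom T',
           forall x : E, T' (i x) = T x &
           opnorm T' <= C * opnorm T].

(** The [h j] are the coordinates of the extended operator, multiplied back by the weights. In the
    constant, the operator norm 2 K^(1/p) meets (K M)^(1-1/p), where K M with M = 2^(1/(p-1)) + 1
    bounds the total mass; the powers of K combine to K. *)
Lemma weak_extension_scalar (i : {linear E -> Z}) (C K : R) (m : nat)
    (phi : 'I_m -> {scalar E}) : weak_extension i C -> 0 < K ->
  (forall s : seq E, \sum_(j < m) \big[Num.max/0]_(x <- s) `|phi j x| <=
     K * (\sum_(x <- s) `|x| `^ p) `^ p^-1) ->
  exists h : 'I_m -> {scalar Z},
    [/\ forall j x y, h j (ljoin x y) = Num.max (h j x) (h j y),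
        forall j x, h j (i x) = phi j x &
        forall z, \sum_(j < m) `|h j z| <=
          2 * (2 `^ (p - 1)^-1 + 1) `^ (1 - p^-1) * (Num.max C 0 * K) * `|z|].
Proof.
(* The empty family is treated apart, since [atomic_norm_lower] asks for positive total mass. *)
case: m phi => [|m] phi wext K0 hK.
  exists (fun=> (\0 : {scalar Z})); split=> [[]//|[]//|z].
  by rewrite big_ord0 !mulr_ge0 ?powR_ge0 ?(ltW K0)// le_max lexx orbT.
have [w [w0 wK wphi]] := weak_density p1 K0 hK.
(* The default 1 only completes the weights to a function on [nat]; it never enters the measure. *)
pose ext (k : nat) : R := oapp w 1 (insub k).
have ext0 k : 0 <= ext k by rewrite /ext; case: insub => //= j; exact: ltW.
pose wn k := NngNum (ext0 k).
have wnE (j : 'I_m.+1) : (wn j)%:num = w j by rewrite /= /ext valK.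
have wn0 (j : 'I_m.+1) : 0 < (wn j)%:num by rewrite wnE.
pose f x k := oapp (fun j => phi j x / w j) 0 (insub k : option 'I_m.+1).
have fE x (j : 'I_m.+1) : w j * `|f x j| = `|phi j x|.
  by rewrite /f valK/= normrM mulrC normfV (gtr0_norm (w0 j)) divfK ?gt_eqF.
pose T x := atomic_class wn m.+1 p1 (f x).
have Tlin : linear T.
  move=> a x y; rewrite /T /atomic_class -weak_classZ -weak_classD.
  apply/weak_classP; apply: aeW => k; rewrite /= !fctE /f.
  case: insub => [j|] /=; last by rewrite scaler0 addr0.
  by rewrite linearP mulrDl -mulrA.
pose TL : {linear E -> weakLp (atomic_measure wn m.+1) p1} :=
  HB.pack T (GRing.isLinear.Build _ _ _ _ T Tlin).
pose B := 2 * K `^ p^-1.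
have B0 : 0 <= B by rewrite mulr_ge0// powR_ge0.
have TB x : `|TL x| <= B * `|x|.
  apply: norm_atomic_class; first by rewrite mulr_ge0.
  move=> A; under eq_bigr do rewrite wnE.
  under [X in _ -> _ * X <= _]eq_bigr do rewrite wnE fE.
  move=> A0.
  apply: (weak_density_bound (g := fun x => \sum_(k < m.+1 | A k) `|phi k x|)) => //.
  by move=> c y c0; rewrite mulr_sumr; apply: eq_bigr => k _; rewrite linearZ normrM ger0_norm.
have [bT nT] := opnorm_lub B0 TB.
have [T' [[bT' T'join _] T'i nT']] := wext _ _ _ TL bT.
have T'B z : `|T' z| <= Num.max C 0 * B * `|z|.
  apply: le_trans (opnorm_ub z bT') _; rewrite ler_wpM2r//.
  apply: le_trans nT' _; apply: (@le_trans _ _ (Num.max C 0 * opnorm TL)).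
    by rewrite ler_wpM2r ?opnorm_ge0// le_max lexx.
  by rewrite ler_wpM2l// le_max lexx orbT.
pose h j z := w j * repr (T' z) j.
have hlin j : scalar (h j).
  move=> a x y; rewrite /h linearP repr_weakP; first by ring.
  by rewrite wnE.
pose hL j : {scalar Z} :=
  HB.pack (h j) (GRing.isLinear.Build R Z R *%R (h j) (hlin j)).
exists hL.
split=> [j x y|j x|z] /=.
- by rewrite /h T'join repr_weak_join ?wnE// maxr_pMr// ltW.
- rewrite /h T'i [TL x]/(weak_class _) repr_weak_class ?wnE//=.
  by rewrite /f valK/= mulrC divfK ?gt_eqF.
- have WE : \sum_(j < m.+1) (wn j)%:num = \sum_(j < m.+1) w j.
    by apply: eq_bigr => j _; rewrite wnE.
  have := atomic_norm_lower (w := wn) (m := m.+1) (T' z).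
  rewrite WE.
  have hE : \sum_(j < m.+1) `|h j z| =
      \sum_(k < m.+1) (wn k)%:num * `|repr (T' z) k|.
    by apply: eq_bigr => j _; rewrite wnE /h normrM gtr0_norm.
  have W0 : 0 < \sum_(j < m.+1) w j.
    by rewrite big_ord_recl ltr_pwDl ?sumr_ge0// => j _; exact: ltW.
  rewrite -hE => /(_ W0) /le_trans; apply.
  set M := 2 `^ (p - 1)^-1 + 1; have M0 : 0 <= M by rewrite addr_ge0 ?powR_ge0.
  have a0 : 0 <= 1 - p^-1.
    by rewrite subr_ge0 invf_le1 ?(ltW p1)// (lt_trans _ p1).
  apply: (@le_trans _ _ ((K * M) `^ (1 - p^-1) * (Num.max C 0 * B * `|z|))).
    apply: ler_pM => //; rewrite ?powR_ge0//.
    by rewrite ge0_ler_powR ?nnegrE ?(ltW W0)// mulr_ge0 ?(ltW K0).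
  rewrite powRM ?(ltW K0)// /B.
  have KE : K `^ (1 - p^-1) * K `^ p^-1 = K.
    by rewrite -powRD ?subrK ?powRr1 ?(ltW K0)// oner_eq0.
  rewrite -[in leRHS]KE le_eqVlt; apply/orP; left; apply/eqP; ring.
Qed.

End weak_extension.

(** * Closure of the generated graph *)

Section lattice_graph.
Context {R : realType} {E : normedModType R} {Z X : normedLatticeType R}.
Variables (i : {linear E -> Z}) (S : {linear E -> X}).

(** A relation, because single-valuedness only comes from the norm bound. Meets are obtained through
    [lmeetE]. *)
Inductive lattice_graph : Z -> X -> Prop :=
| graph_base x : lattice_graph (i x) (S x)
| graph_linear a z y z' y' : lattice_graph z y -> lattice_graph z' y' ->
    lattice_graph (a *: z + z') (a *: y + y')
| graph_join z y z' y' : lattice_graph z y -> lattice_graph z' y' ->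
    lattice_graph (ljoin z z') (ljoin y y').

Lemma graph0 : lattice_graph 0 0.
Proof. by have := graph_base 0; rewrite !linear0. Qed.

Lemma graph_sub z y z' y' : lattice_graph z y -> lattice_graph z' y' ->
  lattice_graph (z - z') (y - y').
Proof.
move=> zy zy'; have := graph_linear (-1) zy' zy.
by rewrite !scaleN1r ![- _ + _]addrC.
Qed.

Lemma graph_add z y z' y' : lattice_graph z y -> lattice_graph z' y' ->
  lattice_graph (z + z') (y + y').
Proof. by move=> zy zy'; have := graph_linear 1 zy zy'; rewrite !scale1r. Qed.

Lemma graph_sublattice : sublattice [set z | exists y, lattice_graph z y].
Proof.
split=> /=.
- by exists 0; exact: graph0.
- move=> a z z' [y zy] [y' zy']; exists (a *: y + y'); exact: graph_linear.
- move=> z z' [y zy] [y' zy']; exists (ljoin y y'); exact: graph_join.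
- move=> z z' [y zy] [y' zy']; exists (y + y' - ljoin y y'); rewrite lmeetE.
  by apply: graph_sub; [exact: graph_add|exact: graph_join].
Qed.

(** The projection of the graph to [Z] is a sublattice containing [range i], hence contains the
    dense one generated by it. *)
Lemma graph_dense (z : Z) (e : R) : generates (range i) -> 0 < e ->
  exists z' y', lattice_graph z' y' /\ `|z - z'| < e.
Proof.
move=> gen e0; have [|z' [/=]] := gen _ _ (ball_open z e).
  by exists z; exact: ballxx.
rewrite -ball_normE/= => zz' /(_ [set z | exists y, lattice_graph z y])[].
  split; first exact: graph_sublattice.
  by move=> _ [x _ <-]; exists (S x); exact: graph_base.
by move=> y zy; exists z', y.
Qed.

(** The list [s] records the difference [y - y'] at every join used to build the pair. A functional
    definite at all of these turns each join into a maximum, exactly as [h] does, so the two agree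
    by induction. *)
Lemma graph_functional z y : lattice_graph z y -> exists s : seq X,
  forall (f : {scalar X}) (h : {scalar Z}),
    positive_functional f -> (forall x, x \in s -> definite_at f x) ->
    (forall u v, h (ljoin u v) = Num.max (h u) (h v)) ->
    (forall x, h (i x) = f (S x)) -> h z = f y.
Proof.
elim=> [x|a {}z {}y z' y' _ [s IH] _ [s' IH']|{}z {}y z' y' _ [s IH] _ [s' IH']].
- by exists [::] => f h _ _ _ ->.
- exists (s ++ s') => f h f0 fs hjoin hi; rewrite !linearP.
  rewrite (IH f h)// ?(IH' f h)// => x xs; apply: fs;
    by rewrite mem_cat xs ?orbT.
- exists (y - y' :: s ++ s') => f h f0 fs hjoin hi.
  rewrite hjoin (IH f h)// ?(IH' f h)//.
  + by rewrite definite_join//; apply: fs; rewrite mem_head.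
  + by move=> x xs; apply: fs; rewrite inE mem_cat xs !orbT.
  + by move=> x xs; apply: fs; rewrite inE mem_cat xs orbT.
Qed.

Lemma positive_bigmax (f : {scalar X}) (s : seq E) : positive_functional f ->
  \big[Num.max/0]_(x <- s) `|f (S x)| <=
    f (\big[@ljoin R X/0]_(x <- s) modulus (S x)).
Proof.
move=> f0; elim: s => [|x s IH]; first by rewrite !big_nil linear0.
rewrite !big_cons ge_max; apply/andP; split.
  rewrite ler_norml lerNl -linearN; apply/andP; split; apply: positive_le => //.
    by apply: lle_trans (lle_joinr _ _) (lle_joinl _ _).
  by apply: lle_trans (lle_joinl _ _) (lle_joinl _ _).
by apply: le_trans IH _; apply: positive_le => //; exact: lle_joinr.
Qed.

Lemma graph_bound (p : R) (p1 : 1 < p) (C K : R) z y :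
  weak_extension p1 i C -> 0 < K -> pinfty_convex_with p S K ->
  lattice_graph z y ->
  `|y| <= 2 * (2 `^ (p - 1)^-1 + 1) `^ (1 - p^-1) * (Num.max C 0 * K) * `|z|.
Proof.
move=> wext K0 [_ conv] zy.
have [f [f0 fy fle]] := norming_functional y.
have [s hs] := graph_functional zy.
(* The additional element [y - - y] makes each [g j] respect the join that defines [modulus y] as
   well. *)
have [m [g [g0 fE gs]]] := definite_decomposition (y - - y :: s) f0.
pose phi j : {scalar E} := g j \o S.
have [|h [hjoin hi hz]] := @weak_extension_scalar R p p1 E Z i C K m phi wext K0.
  move=> t; apply: (@le_trans _ _ (f (\big[@ljoin R X/0]_(x <- t) modulus (S x)))).
    by rewrite fE; apply: ler_sum => j _; exact: positive_bigmax.
  apply: le_trans (fle _) _; rewrite !(big_tnth _ _ t).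
  exact: conv.
rewrite -fy fE; apply: le_trans (hz z); apply: ler_sum => j _.
rewrite /modulus definite_join//; last by apply: gs; rewrite mem_head.
rewrite (hs (g j) (h j))// => [|x xs]; last by apply: gs; rewrite inE xs orbT.
by rewrite linearN maxrN.
Qed.

End lattice_graph.

Section graph_closure.
Context {R : realType} {E : normedModType R} {Z X : banachLatticeType R}.
Variables (i : {linear E -> Z}) (S : {linear E -> X}) (M : R).
Hypothesis gen : generates (range i).
Hypothesis M0 : 0 <= M.
Hypothesis bound : forall z y, lattice_graph i S z y -> `|y| <= M * `|z|.

Definition graph_closure (z : Z) (y : X) : Prop :=
  forall e, 0 < e -> exists z' y',
    [/\ lattice_graph i S z' y', `|z - z'| < e & `|y - y'| < e].

Lemma closure_graph z y : lattice_graph i S z y -> graph_closure z y.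
Proof. by move=> zy e e0; exists z, y; rewrite !subrr !normr0. Qed.

Lemma closure_linear a z y z' y' : graph_closure z y -> graph_closure z' y' ->
  graph_closure (a *: z + z') (a *: y + y').
Proof.
(* Adding 1 to the modulus of [a] keeps the divisor positive when [a = 0]. *)
move=> zy zy' e e0; have b0 : 0 < `|a| + 1 by rewrite ltr_wpDl.
have e1 : 0 < e / (2 * (`|a| + 1)) by rewrite divr_gt0// mulr_gt0.
have e2 : 0 < e / 2 by rewrite divr_gt0.
have [z1 [y1 [g1 zz1 yy1]]] := zy _ e1; have [z2 [y2 [g2 zz2 yy2]]] := zy' _ e2.
have main (V : normedModType R) (u u' v v' : V) :
    `|u - u'| < e / (2 * (`|a| + 1)) -> `|v - v'| < e / 2 ->
    `|a *: u + v - (a *: u' + v')| < e.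
  move=> uu vv; rewrite opprD addrACA -scalerBr (splitr e).
  apply: le_lt_trans (ler_normD _ _) _; rewrite ler_ltD// normrZ.
  apply: (@le_trans _ _ ((`|a| + 1) * (e / (2 * (`|a| + 1))))).
    by apply: ler_pM => //; [rewrite lerDl|exact: ltW].
  by rewrite le_eqVlt; apply/orP; left; apply/eqP; field; rewrite gt_eqF.
exists (a *: z1 + z2), (a *: y1 + y2); split; [exact: graph_linear| |]; exact: main.
Qed.

Lemma closure_join z y z' y' : graph_closure z y -> graph_closure z' y' ->
  graph_closure (ljoin z z') (ljoin y y').
Proof.
move=> zy zy' e e0; have e2 : 0 < e / 2 by rewrite divr_gt0.
have [z1 [y1 [g1 zz1 yy1]]] := zy _ e2; have [z2 [y2 [g2 zz2 yy2]]] := zy' _ e2.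
exists (ljoin z1 z2), (ljoin y1 y2); split; first exact: graph_join.
  by apply: le_lt_trans (norm_ljoinB _ _ _ _) _; rewrite (splitr e) ltrD.
by apply: le_lt_trans (norm_ljoinB _ _ _ _) _; rewrite (splitr e) ltrD.
Qed.

Lemma closure_bound z y : graph_closure z y -> `|y| <= M * `|z|.
Proof.
move=> zy; apply/ler_addgt0Pr => e e0.
(* With this tolerance d the total error is d + M d = e. *)
have d0 : 0 < e / (M + 1) by rewrite divr_gt0// ltr_wpDl.
have [z1 [y1 [/bound g1 zz1 yy1]]] := zy _ d0.
have z1z : `|z1| <= `|z| + e / (M + 1).
  rewrite -[z1](subrK z) addrC; apply: le_trans (ler_normD _ _) _.
  by rewrite lerD2l distrC ltW.
rewrite -[y](subrK y1); apply: le_trans (ler_normD _ _) _.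
apply: (@le_trans _ _ (e / (M + 1) + M * (`|z| + e / (M + 1)))).
  by rewrite lerD// ?(ltW yy1)// (le_trans g1)// ler_wpM2l.
rewrite le_eqVlt; apply/orP; left; apply/eqP; field.
by rewrite gt_eqF// ltr_wpDl.
Qed.

(** The difference of the two pairs lies over 0, where [closure_bound] leaves only 0. *)
Lemma closure_inj z y y' : graph_closure z y -> graph_closure z y' -> y = y'.
Proof.
move=> zy zy'; have := closure_bound (closure_linear (-1) zy' zy).
by rewrite !scaleN1r addNr normr0 mulr0 normr_le0 addrC subr_eq0 => /eqP.
Qed.

(** Take pairs of the graph whose first components tend to [z]. The bound, applied to their
    differences, makes the second components Cauchy, and [X] is complete. *)
Lemma closure_total z : exists y, graph_closure z y.
Proof.
have e0 n : 0 < n.+1%:R^-1 :> R by rewrite invr_gt0.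
have /choice[u uP] n : exists zy : Z * X,
    lattice_graph i S zy.1 zy.2 /\ `|z - zy.1| < n.+1%:R^-1.
  have [z' [y' zy']] := graph_dense S z gen (e0 n); by exists (z', y').
have small (e : R) : 0 < e -> \forall n \near \oo, n.+1%:R^-1 < e.
  by move=> e_gt0; have := near_infty_natSinv_lt (PosNum e_gt0).
have cu : cvg ((u n).2 @[n --> \oo]).
  apply/cauchy_cvgP/cauchy_exP => e e_gt0.
  pose d := e / (2 * (M + 1)); have d0 : 0 < d.
    by rewrite divr_gt0// mulr_gt0// ltr_wpDl.
  have [N _ Nd] := small _ d0; exists (u N).2; exists N => // n /= Nn.
  rewrite -ball_normE/=; have [gN zN] := uP N; have [gn zn] := uP n.
  apply: le_lt_trans (bound (graph_sub gN gn)) _.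
  have zNn : `|(u N).1 - (u n).1| <= 2 * d.
    rewrite -(subrKA z) mulr_natl mulr2n (le_trans (ler_normD _ _))// lerD//.
      by rewrite distrC ltW// (lt_trans zN)//; exact: Nd (leqnn N).
    by rewrite ltW// (lt_trans zn)//; exact: Nd.
  apply: (@le_lt_trans _ _ (M * (2 * d))); first by rewrite ler_wpM2l.
  have -> : e = (M + 1) * (2 * d) by rewrite /d; field; rewrite gt_eqF// ltr_wpDl.
  by rewrite ltr_pM2r ?ltrDl// mulr_gt0.
exists (lim ((u n).2 @[n --> \oo])) => e e_gt0.
have /cvgrPdist_lt/(_ e e_gt0) cl := cu.
have [n [yn zn]] : exists n, `|lim ((u n).2 @[n --> \oo]) - (u n).2| < e /\
    n.+1%:R^-1 < e.
  near \oo => n; exists n; split; near: n; [exact: cl|exact: small].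
exists (u n).1, (u n).2; split=> //; first by have [] := uP n.
by apply: lt_trans zn; have [] := uP n.
Unshelve. all: by end_near.
Qed.

(** The source of uniqueness: an extension agrees with the graph by induction on its construction,
    and boundedness carries this to the closure. *)
Lemma lattice_hom_closure (f : {linear Z -> X}) : lattice_hom f ->
  (forall x, f (i x) = S x) -> forall z y, graph_closure z y -> f z = y.
Proof.
move=> [bf fjoin _] fi; have fg z y : lattice_graph i S z y -> f z = y.
  elim=> {z y} [x|a z y z' y' _ <- _ <-|z y z' y' _ <- _ <-] //.
  by rewrite linearP.
move=> z y zy; apply/eqP; rewrite -subr_eq0 -normr_le0; apply/ler_addgt0Pr => e e0.
rewrite add0r; have d0 : 0 < e / (opnorm f + 1).
  by rewrite divr_gt0// ltr_wpDl ?opnorm_ge0.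
have [z1 [y1 [/fg <- zz1 yy1]]] := zy _ d0.
rewrite -(subrKA (f z1)) -linearB (le_trans (ler_normD _ _))// [`|_ - y|]distrC.
apply: (@le_trans _ _ (opnorm f * (e / (opnorm f + 1)) + e / (opnorm f + 1))).
  rewrite lerD ?(ltW yy1)// (le_trans (opnorm_ub _ bf))//.
  by rewrite ler_wpM2l ?opnorm_ge0// ltW.
rewrite le_eqVlt; apply/orP; left; apply/eqP; field.
by rewrite gt_eqF// ltr_wpDl ?opnorm_ge0.
Qed.

(** The closure is total and single-valued, hence the graph of a map; its stability under linear
    combinations and joins becomes linearity and preservation of joins. *)
Lemma lattice_hom_extension : exists S' : {linear Z -> X},
  [/\ lattice_hom S', forall x, S' (i x) = S x &
      forall z, graph_closure z (S' z)].
Proof.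
have [f fP] := choice closure_total.
have flin : linear f.
  by move=> a u v; apply: closure_inj (fP _) _; exact: closure_linear.
pose F : {linear Z -> X} := HB.pack f (GRing.isLinear.Build _ _ _ _ f flin).
have Fjoin : {morph F : x y / ljoin x y >-> ljoin x y}.
  by move=> u v; apply: closure_inj (fP _) _; exact: closure_join.
have [bF _] := opnorm_lub (f := F) M0 (fun z => closure_bound (fP z)).
exists F; split=> //; last first.
  by move=> x; apply: closure_inj (fP _) _; apply: closure_graph; exact: graph_base.
by split=> // u v; rewrite !lmeetE linearB linearD Fjoin.
Qed.

End graph_closure.

(** * The convexity constant and the norm of the extension *)

Lemma pinfty_convex_const_ge0 (R : realType) (p : R) (V : normedModType R)
    (X : normedLatticeType R) (S : V -> X) : 0 <= pinfty_convex_const p S.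
Proof.
rewrite /pinfty_convex_const; set A := [set K | _].
(* The infimum of the empty set is 0 by convention. *)
have [->|/set0P A0] := eqVneq A set0; first by rewrite inf0.
by apply: lb_le_inf => // K [].
Qed.

(** Staying strictly above the infimum avoids the question whether it is attained, and yields the
    positive [K] that [graph_bound] requires. *)
Lemma pinfty_convex_gt_const (R : realType) (p K : R) (V : normedModType R)
    (X : normedLatticeType R) (S : V -> X) : pinfty_convex p S ->
  pinfty_convex_const p S < K -> pinfty_convex_with p S K.
Proof.
move=> [K0 hK0] cK; have K_gt0 : 0 < K.
  exact: le_lt_trans (pinfty_convex_const_ge0 p S) cK.
have hinf : has_inf [set K | pinfty_convex_with p S K].
  by split; [exists K0|exists 0 => L []].
have d0 : 0 < K - pinfty_convex_const p S by rewrite subr_gt0.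
have [L [_ hL] LK] := inf_adherent d0 hinf.
split=> [|n x]; first exact: ltW.
apply: le_trans (hL n x) _; rewrite ler_wpM2r ?powR_ge0//.
by rewrite ltW// (lt_le_trans LK)// addrC subrK.
Qed.

Theorem proposition9p36 (R : realType) (p : R) (p1 : 1 < p) :
  exists gamma : R,
  forall (E : completeNormedModType R) (Z : banachLatticeType R)
    (i : {linear E -> Z}) (C : R),
  (forall x : E, `|i x| = `|x|) ->
  generates (range i) ->
  (forall (d : measure_display) (Omega : measurableType d)
     (mu : {finite_measure set Omega -> \bar R})
     (T : {linear E -> weakLp mu p1}),
     bounded_fun_norm T ->
     exists T' : {linear Z -> weakLp mu p1},
       [/\ lattice_hom T',
           forall x : E, T' (i x) = T x &
           opnorm T' <= C * opnorm T]) ->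
  forall (X : banachLatticeType R) (S : {linear E -> X}),
  pinfty_convex p S ->
  exists S' : {linear Z -> X},
    [/\ lattice_hom S',
        forall x : E, S' (i x) = S x,
        forall S'' : {linear Z -> X}, lattice_hom S'' ->
          (forall x : E, S'' (i x) = S x) -> S'' =1 S' &
        opnorm S' <= gamma * C * pinfty_convex_const p S].
Proof.
pose c := 2 * (2 `^ (p - 1)^-1 + 1) `^ (1 - p^-1).
have c0 : 0 <= c by rewrite mulr_ge0 ?powR_ge0.
exists c => E Z i C iso gen wext X S Sconv.
set k := pinfty_convex_const p S.
have k0 : 0 <= k := pinfty_convex_const_ge0 p S.
have maxC0 : 0 <= Num.max C 0 by rewrite le_max lexx orbT.
have bound (K : R) : k < K -> forall z y, lattice_graph i S z y ->
    `|y| <= c * (Num.max C 0 * K) * `|z|.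
  move=> kK z y; apply: (graph_bound (p1 := p1)) => //.
    exact: le_lt_trans k0 kK.
  exact: pinfty_convex_gt_const.
have M0 (K : R) : k < K -> 0 <= c * (Num.max C 0 * K).
  by move=> kK; rewrite !mulr_ge0// (le_trans k0)// ltW.
have k1 : k < k + 1 by rewrite ltrDl.
(* The choice of [k + 1] serves existence only: the closure containing the graph of [S'] does not
   depend on [K], so the bounds for all [K > k] apply to the same [S']. *)
have [S' [S'hom S'i S'g]] := lattice_hom_extension gen (M0 _ k1) (bound _ k1).
exists S'; split=> // [S'' S''hom S''i z|].
  by rewrite (lattice_hom_closure S''hom S''i (S'g z)).
have S'K (K : R) : k < K -> opnorm S' <= c * (Num.max C 0 * K).
  move=> kK; have [] // := opnorm_lub (f := S') (M0 _ kK).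
  by move=> z; exact: (closure_bound (M0 _ kK) (bound _ kK) (S'g z)).
(* Let [K] decrease to [k]; a vanishing factor is set aside to allow the division. *)
have S'k : opnorm S' <= c * Num.max C 0 * k.
  have [b0|b0] := eqVneq (c * Num.max C 0) 0.
    by have := S'K _ k1; rewrite mulrA b0 !mul0r.
  have {}b0 : 0 < c * Num.max C 0 by rewrite lt_neqAle eq_sym b0 mulr_ge0.
  apply/ler_addgt0Pr => e e0; have ke : k < k + e / (c * Num.max C 0).
    by rewrite ltrDl divr_gt0.
  have := S'K _ ke; rewrite mulrA mulrDr.
  by rewrite [_ * (e / _)]mulrCA divff ?mulr1// gt_eqF.
(* For negative [C] the estimate gives [S' = 0], so [S = 0] and [k = 0], and the claimed bound is
   0. *)
have [C0|C0] := leP 0 C; first by move: S'k; rewrite (max_idPl C0).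
move: S'k; rewrite (max_idPr (ltW C0)) mulr0 mul0r => S'0.
have S0 x : S x = 0.
  have [bS' _ _] := S'hom; apply/eqP; rewrite -normr_le0 -S'i.
  by apply: le_trans (opnorm_ub _ bS') _; rewrite mulr_le0_ge0.
have kle0 : k <= 0.
  apply: ge_inf; first by exists 0 => L [].
  split=> // n x; rewrite mul0r normr_le0; apply/eqP; elim/big_ind: _ => //.
    by move=> u v -> ->; apply: ljoin_idl; exact: lle_refl.
  by move=> j _; rewrite S0 modulus_id//; exact: lle_refl.
have kE : k = 0 by apply/eqP; rewrite eq_le kle0.
by rewrite kE mulr0.
Qed.
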